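(* Let $\mathcal{B}$ be the class of bichain graphs and $\mathcal{S}$ the class of split permutation graphs. Then each of $\mathcal{B}$ and $\mathcal{S}$ is a minimal hereditary class of unbounded clique-width (i.e.\ it has unbounded clique-width, while every proper hereditary subclass has bounded clique-width). Moreover, each of $\mathcal{B}$ and $\mathcal{S}$ contains a canonical labelled infinite antichain whose labels come from a set of two incomparable labels.
   Context: All graphs are finite and simple. A class of graphs is hereditary if it is closed under taking induced subgraphs. A set of vertices forms a chain if their neighbourhoods are linearly ordered by inclusion. A bichain graph is a bipartite graph admitting a bipartition in which each of the two parts can be divided into at most two chains. A split permutation graph is a graph that is both a split graph (its vertex set partitions into a clique and an independent set) and a permutation graph. The clique-width of $G$ is the least size of a label set $\Sigma$ such that $G$ can be built using the operations: create a single vertex with label $i\in\Sigma$; for distinct $i,j$, add all edges between vertices labelled $i$ and vertices labelled $j$; relabel all vertices labelled $i$ to $j$; take the disjoint union of two already constructed labelled graphs. A class has bounded clique-width if some constant bounds the clique-width of all its members. Labelled graphs: for a quasi-ordered set $(W,\le)$, a labelled graph is a pair $(G,\ell)$ with $\ell:V(G)\to W$; $(H,k)$ is a labelled induced subgraph of $(G,\ell)$ if there is an injective map $\phi:V(H)\to V(G)$ with $uv\in E(H)\iff\phi(u)\phi(v)\in E(G)$ and $k(v)\le \ell(\phi(v))$ for all $v$. A class of graphs is labelled well-quasi-ordered if for every well-quasi-ordered $(W,\le)$ the $W$-labelled graphs whose underlying graphs lie in the class contain no infinite antichain under the labelled induced subgraph relation. A labelled infinite antichain $\mathcal{A}$ (of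 labelled graphs whose underlying graphs lie in a hereditary class $\mathcal{C}$) is canonical if every hereditary subclass of $\mathcal{C}$ containing only finitely many of the underlying unlabelled graphs of $\mathcal{A}$ is labelled well-quasi-ordered. ''Two incomparable labels'' means the label set is $W=\{a,b\}$ with $a,b$ incomparable. *)

(* Defs.v *)
From mathcomp Require Import all_boot.
Set Implicit Arguments. Unset Strict Implicit. Unset Printing Implicit Defensive.

Record graph := Graph {
  gV : finType;
  gadj : rel gV;
  gadj_sym : symmetric gadj;
  gadj_irr : irreflexive gadj }.
Arguments gadj : clear implicits.

Definition induced_emb (H G : graph) (f : gV H -> gV G) : Prop :=
  injective f /\ forall u v, gadj H u v = gadj G (f u) (f v).

Definition induced_sub (H G : graph) : Prop :=
  exists f : gV H -> gV G, induced_emb f.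

Definition graph_class := graph -> Prop.

Definition hereditary (C : graph_class) : Prop :=
  forall G H, C G -> induced_sub H G -> C H.

Record lgraph (k : nat) := LGraph {
  lV : finType;
  lE : rel lV;
  llab : lV -> 'I_k }.
Arguments lV {k}.
Arguments lE {k} l.
Arguments llab {k} l.

Definition lg_vertex k (i : 'I_k) : lgraph k :=
  @LGraph k unit (fun _ _ => false) (fun _ => i).

Definition lg_join k (i j : 'I_k) (L : lgraph k) : lgraph k :=
  @LGraph k (lV L)
    (fun x y => [|| lE L x y, (llab L x == i) && (llab L y == j)
                         | (llab L x == j) && (llab L y == i)])
    (llab L).

Definition lg_relab k (i j : 'I_k) (L : lgraph k) : lgraph k :=
  @LGraph k (lV L) (lE L) (fun x => if llab L x == i then j else llab L x).

Definition lg_union k (L1 L2 : lgraph k) : lgraph k :=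
  @LGraph k (lV L1 + lV L2)%type
    (fun x y => match x, y with
                | inl a, inl b => lE L1 a b
                | inr a, inr b => lE L2 a b
                | _, _ => false end)
    (fun x => match x with inl a => llab L1 a | inr a => llab L2 a end).

Inductive cw_constructible (k : nat) : lgraph k -> Prop :=
| cw_vertex (i : 'I_k) : cw_constructible (lg_vertex i)
| cw_join (i j : 'I_k) (L : lgraph k) :
    i != j -> cw_constructible L -> cw_constructible (lg_join i j L)
| cw_relab (i j : 'I_k) (L : lgraph k) :
    cw_constructible L -> cw_constructible (lg_relab i j L)
| cw_union (L1 L2 : lgraph k) :
    cw_constructible L1 -> cw_constructible L2 -> cw_constructible (lg_union L1 L2).

(* clique-width of G is at most k (the null graph has clique-width 0) *)
Definition cw_le (k : nat) (G : graph) : Prop :=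
  #|gV G| = 0 \/
  exists L : lgraph k, cw_constructible L /\
    exists f : lV L -> gV G, bijective f /\
      forall x y, lE L x y = gadj G (f x) (f y).

Definition bounded_cw (C : graph_class) : Prop :=
  exists k, forall G, C G -> cw_le k G.

Definition minimal_unbounded_cw (C : graph_class) : Prop :=
  [/\ hereditary C, ~ bounded_cw C &
      forall D : graph_class, hereditary D -> (forall G, D G -> C G) ->
        (exists G, C G /\ ~ D G) -> bounded_cw D].

Definition nbhd (G : graph) (x : gV G) : {set gV G} := [set y | gadj G x y].

Definition is_chain (G : graph) (S : {set gV G}) : Prop :=
  forall x y, x \in S -> y \in S ->
    (nbhd x \subset nbhd y) || (nbhd y \subset nbhd x).

Definition independent (G : graph) (S : {set gV G}) : Prop :=
  forall x y, x \in S -> y \in S -> ~~ gadj G x y.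

Definition clique (G : graph) (S : {set gV G}) : Prop :=
  forall x y, x \in S -> y \in S -> x != y -> gadj G x y.

Definition two_chains (G : graph) (S : {set gV G}) : Prop :=
  exists S1 S2 : {set gV G}, S = S1 :|: S2 /\ is_chain S1 /\ is_chain S2.

Definition bichain (G : graph) : Prop :=
  exists A B : {set gV G},
    [/\ A :|: B = setT, [disjoint A & B], independent A, independent B &
        two_chains A /\ two_chains B].

Definition split_graph (G : graph) : Prop :=
  exists K I : {set gV G},
    [/\ K :|: I = setT, [disjoint K & I], clique K & independent I].

(* two linear orders (given by injective ranks p, q); xy is an edge iff
   the two orders disagree on x, y *)
Definition permutation_graph (G : graph) : Prop :=
  exists p q : gV G -> nat,
    [/\ injective p, injective q &
        forall x y, x != y -> gadj G x y = ((p x < p y) != (q x < q y))].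

Definition split_permutation (G : graph) : Prop :=
  split_graph G /\ permutation_graph G.

Definition quasi_order (W : Type) (le : W -> W -> Prop) : Prop :=
  (forall x, le x x) /\ (forall x y z, le x y -> le y z -> le x z).

Definition wqo (W : Type) (le : W -> W -> Prop) : Prop :=
  quasi_order le /\ forall s : nat -> W, exists i j, i < j /\ le (s i) (s j).

Record lab_graph (W : Type) := LabGraph {
  lg : graph;
  lgl : gV lg -> W }.
Arguments lg {W}.
Arguments lgl {W} l.

Definition lab_sub (W : Type) (le : W -> W -> Prop) (H G : lab_graph W) : Prop :=
  exists f : gV (lg H) -> gV (lg G),
    induced_emb f /\ forall v, le (lgl H v) (lgl G (f v)).

Definition lab_antichain (W : Type) (le : W -> W -> Prop)
    (A : nat -> lab_graph W) : Prop :=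
  forall i j, i <> j -> ~ lab_sub le (A i) (A j).

Definition lab_wqo (C : graph_class) : Prop :=
  forall (W : Type) (le : W -> W -> Prop), wqo le ->
    ~ exists A : nat -> lab_graph W,
        (forall i, C (lg (A i))) /\ lab_antichain le A.

Definition canonical_antichain (C : graph_class) (W : Type)
    (le : W -> W -> Prop) (A : nat -> lab_graph W) : Prop :=
  [/\ forall i, C (lg (A i)), lab_antichain le A &
      forall D : graph_class, hereditary D -> (forall G, D G -> C G) ->
        (exists N, forall i, N <= i -> ~ D (lg (A i))) -> lab_wqo D].

(* Main.v *)
Require Import Defs.
From mathcomp Require Import all_boot zify.
From Stdlib Require Import Classical ClassicalEpsilon.
Set Implicit Arguments. Unset Strict Implicit. Unset Printing Implicit Defensive.

(** Both classes consist of the graphs drawn in a grid of columns and rows, with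
the parity of the column of a vertex giving its side: an even vertex [a] and an
odd vertex [b] are adjacent iff [a] is before [b], where columns at distance at
least 2 are compared by column and neighbouring columns by row.  Such a drawing
exists because "before" is a tournament between the two sides, and breadth-first
search along predecessors from a suitable vertex yields layers that are chains;
the vertices reached precede all the others, so the construction can be repeated
on the rest.

Unboundedness: a balanced set of vertices of the square grid with few outside
neighbourhoods would have almost monochromatic rows, and two rows of different
colours already give many outside neighbourhoods.

Minimality: excluding the n x n grid forces the descending trajectories starting
in one column to merge into fewer than n trajectories within n columns.  The
vertices enclosed by merging trajectories, together with all earlier columns,
then have boundedly many outside neighbourhoods; between two such sets the
vertices are added row by row.

Antichain: a spiral has one vertex in each column, in descending rows, with its
two ends marked.  An embedding of spirals advances by at most one column per
step, so it cannot map ends to ends unless the lengths agree.  A breadth-first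
search with many layers contains a long spiral; hence excluding a spiral bounds
the number of layers, each graph is coded by a word of words over a finite
alphabet of layers times labels, and Higman's lemma applies twice. *)

(** * Clique-width and sets with few outside neighbourhoods *)

(** The classes of [kap] may be finer than equality of outside neighbourhoods, so any convenient
    invariant with [k] values can serve as a witness. *)
Definition cut_le k (V : finType) (e : rel V) (X : {set V}) :=
  exists kap : V -> 'I_k, forall x x' y,
    x \in X -> x' \in X -> y \notin X -> kap x = kap x' -> e x y = e x' y.

(** Descend through the construction to a union whose parts both have at most [M] vertices. Vertices
    with equal labels at that moment are treated alike by everything added later. The classes are
    also required to determine the current label, so that the induction passes through joins and
    relabellings. *)
Lemma constructible_balanced_cut k (L : lgraph k) M :
  cw_constructible L -> 0 < M < #|lV L| ->
  exists X : {set lV L}, [/\ #|X| <= M, M < 2 * #|X| &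
    exists kap : lV L -> 'I_k, forall x x', x \in X -> x' \in X ->
      kap x = kap x' -> llab L x = llab L x' /\
      forall y, y \notin X -> lE L x y = lE L x' y].
Proof.
elim=> {L}[i|i j L _ _ IH|i j L _ IH|L1 L2 _ IH1 _ IH2].
- by rewrite /= card_unit; lia.
- move=> /IH [X [h1 h2 [kap hk]]]; exists X; split=> //; exists kap => x x' xX x'X ex.
  have [hl he] := hk _ _ xX x'X ex; split=> //= y yX.
  by rewrite he // hl.
- move=> /IH [X [h1 h2 [kap hk]]]; exists X; split=> //; exists kap => x x' xX x'X ex.
  have [hl he] := hk _ _ xX x'X ex; split=> //=; by rewrite hl.
- rewrite /= card_sum => /andP[M0 hM].
  case: (ltnP M #|lV L1|) => h1.
  + have [|X [hX1 hX2 [kap hk]]] := IH1; first by rewrite M0.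
    exists [set inl x | x in X]; rewrite !card_imset; try by move=> ? ? [].
    split=> //; exists (fun z => match z with inl a => kap a | inr b => llab L2 b end).
    move=> _ _ /imsetP[x xX ->] /imsetP[x' x'X ->] /= ex.
    have [hl he] := hk _ _ xX x'X ex; split=> // -[y|y] // yX /=.
    by apply: he; apply: contra yX => yX; apply: imset_f.
  case: (ltnP M #|lV L2|) => h2.
  + have [|X [hX1 hX2 [kap hk]]] := IH2; first by rewrite M0.
    exists [set inr x | x in X]; rewrite !card_imset; try by move=> ? ? [].
    split=> //; exists (fun z => match z with inr a => kap a | inl b => llab L1 b end).
    move=> _ _ /imsetP[x xX ->] /imsetP[x' x'X ->] /= ex.
    have [hl he] := hk _ _ xX x'X ex; split=> // -[y|y] // yX /=.
    by apply: he; apply: contra yX => yX; apply: imset_f.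
  (* Both parts are small but their sum exceeds [M], so twice the larger part exceeds [M]. *)
  case: (leqP #|lV L2| #|lV L1|) => h12.
  + exists [set inl x | x in setT]; rewrite card_imset; last by move=> ? ? [].
    rewrite cardsT; split=> //; first by lia.
    exists (fun z => match z with inl a => llab L1 a | inr b => llab L2 b end).
    move=> _ _ /imsetP[x _ ->] /imsetP[x' _ ->] ex; split=> // -[y|y] //.
    by rewrite imset_f.
  + exists [set inr x | x in setT]; rewrite card_imset; last by move=> ? ? [].
    rewrite cardsT; split=> //; first by lia.
    exists (fun z => match z with inl a => llab L1 a | inr b => llab L2 b end).
    move=> _ _ /imsetP[x _ ->] /imsetP[x' _ ->] ex; split=> // -[y|y] //.
    by rewrite imset_f.
Qed.

Lemma cw_balanced_cut k (G : graph) M :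
  cw_le k G -> 0 < M < #|gV G| ->
  exists X : {set gV G}, [/\ #|X| <= M, M < 2 * #|X| & cut_le k (gadj G) X].
Proof.
case=> [->|[L [cL [f [bf he]]]]] hM; first by lia.
have fI := bij_inj bf.
have [|X [h1 h2 [kap hk]]] := constructible_balanced_cut (M := M) cL.
  by rewrite (bij_eq_card bf).
case: bf => g fK gK.
exists [set f x | x in X]; rewrite card_imset //; split=> //.
exists (fun v => kap (g v)) => _ _ y /imsetP[x xX ->] /imsetP[x' x'X ->] yX.
rewrite !fK => ex; have [_ h] := hk _ _ xX x'X ex.
rewrite -(gK y) -!he; apply: h; apply: contra yX => h.
by rewrite -(gK y) imset_f.
Qed.

(* The target labels are fixed by [f], so relabelling one label at a time moves no
   vertex twice. *)
Lemma relabel_idem k (L : lgraph k) (f : 'I_k -> 'I_k) :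
  (forall l, f (f l) = f l) -> cw_constructible L ->
  exists L', cw_constructible L' /\ exists h : lV L' -> lV L,
    [/\ bijective h, forall x y, lE L' x y = lE L (h x) (h y) &
        forall x, llab L' x = f (llab L (h x))].
Proof.
move=> fid cL.
suff: forall s : seq 'I_k, exists L', cw_constructible L' /\ exists h : lV L' -> lV L,
    [/\ bijective h, forall x y, lE L' x y = lE L (h x) (h y) &
        forall x, llab L' x = if llab L (h x) \in s then f (llab L (h x)) else llab L (h x)].
  case/(_ (enum 'I_k)) => L' [cL' [h [b e l]]]; exists L'; split=> //; exists h; split=> // x.
  by rewrite l mem_enum.
elim=> [|i s [L' [cL' [h [b e l]]]]].
  by exists L; split=> //; exists id; split=> //; exists id.
exists (lg_relab i (f i) L'); split; first exact: cw_relab.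
exists h; split=> //= x; rewrite l inE.
case: (altP (llab L (h x) =P i)) => [->|ni] /=.
  by case: (i \in s); rewrite ?eqxx ?if_same //; case: (altP (f i =P i)).
case: (_ \in s); last by rewrite (negPf ni).
by case: ifP => // /eqP efi; rewrite -efi fid.
Qed.

(** Used with [i] the label of a single new vertex and [J] the labels of its neighbours among the
    vertices already built. *)
Lemma join_many k (L : lgraph k) (i : 'I_k) (J : {set 'I_k}) :
  i \notin J -> cw_constructible L ->
  exists L', cw_constructible L' /\ exists h : lV L' -> lV L,
    [/\ bijective h, forall x, llab L' x = llab L (h x) &
      forall x y, lE L' x y = [|| lE L (h x) (h y),
        (llab L (h x) \in J) && (llab L (h y) == i)
      | (llab L (h x) == i) && (llab L (h y) \in J)]].
Proof.
move=> iJ cL.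
suff: forall s : seq 'I_k, i \notin s -> exists L', cw_constructible L' /\ exists h : lV L' -> lV L,
    [/\ bijective h, forall x, llab L' x = llab L (h x) &
      forall x y, lE L' x y = [|| lE L (h x) (h y),
        (llab L (h x) \in s) && (llab L (h y) == i)
      | (llab L (h x) == i) && (llab L (h y) \in s)]].
  case/(_ (enum J)) => [|L' [cL' [h [b l e]]]]; first by rewrite mem_enum.
  exists L'; split=> //; exists h; split=> // x y.
  by rewrite e !mem_enum.
elim=> [_|j s IH].
  by exists L; split=> //; exists id; split=> //; [exists id|move=> x y; rewrite !in_nil andbF !orbF].
rewrite inE negb_or => /andP[ij /IH [L' [cL' [h [b l e]]]]].
exists (lg_join i j L'); split; first exact: cw_join.
exists h; split=> //= x y; rewrite e !l !inE.
case: (lE _ _ _) => //=.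
by case: (llab L (h x) == i); case: (llab L (h y) == i);
   case: (llab L (h x) == j); case: (llab L (h y) == j);
   case: (llab L (h x) \in s); case: (llab L (h y) \in s).
Qed.

Section Linear.
Variables (k : nat) (V : finType) (e : rel V) (key : V -> nat).
Hypothesis esym : symmetric e.
Hypothesis eirr : irreflexive e.
Hypothesis keyI : injective key.
Hypothesis cuts : forall m, cut_le k e [set x | key x < m].

Let K := k.+1 + k.

(* Labels below [k] are the current classes and [k] marks the new vertex.  The
   relabelling to the next classes need not be idempotent, so it goes through the
   spare labels above [k]. *)
Lemma linear_prefix m : (forall v, m <= key v) \/
  exists L : lgraph K, cw_constructible L /\ exists f : lV L -> V,
    [/\ injective f, forall v, (key v < m) <-> exists x, f x = v,
        forall x y, lE L x y = e (f x) (f y),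
        forall x, llab L x < k &
        forall x y z, llab L x = llab L y -> m <= key z -> e (f x) z = e (f y) z].
Proof.
(* The left disjunct stands for the empty prefix, since every construction has a vertex. *)
elim: m => [|m IH]; first by left.
case: (pickP (fun v => key v == m)) => [v /eqP kv|nov]; last first.
  case: IH => [IH|[L [cL [f [fI fim fe fl ft]]]]].
    by left=> v; rewrite ltn_neqAle IH andbT eq_sym nov.
  right; exists L; split=> //; exists f; split=> //.
  - move=> v; rewrite -fim ltnS leq_eqVlt nov /=; tauto.
  - by move=> x y z exy mz; apply: ft => //; apply: ltnW.
right.
have [kap hkap] := cuts m.+1.
have kap_lt x : kap x < K by rewrite /K; have := ltn_ord (kap x); lia.
case: IH => [IH|[L [cL [f [fI fim fe fl ft]]]]].
  have hv w : (key w < m.+1) = (w == v).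
    apply/idP/eqP => [h|->]; last by rewrite kv.
    by apply: keyI; rewrite kv; have := IH w; lia.
  exists (lg_vertex (Ordinal (kap_lt v))); split; first exact: cw_vertex.
  exists (fun _ => v); split=> //=.
  - by case=> -[].
  - move=> w; rewrite hv; split; [by move=> /eqP ->; exists tt|by case=> _ ->; rewrite eqxx].
have k_lt : k < K by rewrite /K; lia.
pose i0 : 'I_K := Ordinal k_lt.
pose L1 := lg_union L (lg_vertex i0).
pose f1 (z : lV L1) : V := match z with inl a => f a | inr _ => v end.
pose J : {set 'I_K} := [set j | [exists x, (llab L x == j) && e (f x) v]].
have i0J : i0 \notin J.
  rewrite inE; apply/existsP => -[x /andP[/eqP h _]].
  by have := fl x; rewrite h /= ltnn.
have cL1 : cw_constructible L1 by apply: cw_union => //; exact: cw_vertex.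
have [L2 [cL2 [h2 [b2 l2 e2]]]] := join_many i0J cL1.
(* A label moves to the next class of one representative. By [tw1] its other vertices have the same
   later neighbours, even if [kap] separates them. Labels without vertices get the default
   [kap v]. *)
pose rho (l : 'I_K) : 'I_k :=
  if [pick z : lV L1 | llab L1 z == l] is Some z then kap (f1 z) else kap v.
have p1 (l : 'I_k) : k.+1 + l < K by rewrite /K; have := ltn_ord l; lia.
pose g1 (l : 'I_K) : 'I_K := if l <= k then Ordinal (p1 (rho l)) else l.
have g1id l : g1 (g1 l) = g1 l.
  rewrite /g1; case: (leqP l k) => h /=; last by rewrite leqNgt h.
  by rewrite ifN // ; lia.
have p2 (l : 'I_K) : l - k.+1 < K by rewrite /K; have := ltn_ord l; rewrite {1}/K; lia.
pose g2 (l : 'I_K) : 'I_K := if k < l then Ordinal (p2 l) else l.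
have g2id l : g2 (g2 l) = g2 l.
  rewrite /g2; case: (ltnP k l) => h /=; last by rewrite ltnNge h.
  have hl : l < K by exact: ltn_ord.
  by rewrite ifN // -leqNgt; move: hl; rewrite /K; lia.
have [L3 [cL3 [h3 [b3 e3 l3]]]] := relabel_idem g1id cL2.
have [L4 [cL4 [h4 [b4 e4 l4]]]] := relabel_idem g2id cL3.
pose h := h2 \o (h3 \o h4).
have bh : bijective h by apply: bij_comp => //; apply: bij_comp.
have ll1 z : llab L1 z <= k by case: z => [a|a] //=; rewrite ltnW.
have ll4 x : nat_of_ord (llab L4 x) = kap (f1 (odflt (h x) [pick z : lV L1 | llab L1 z == llab L1 (h x)])).
  rewrite l4 l3 l2 -/(h x) /g2 /g1 ll1 /= ifT; last by lia.
  rewrite /= /rho; case: pickP => [z _|/(_ (h x))]; last by rewrite eqxx.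
  by rewrite /=; lia.
have f1I : injective f1.
  have nfv a : f a <> v by move=> ea; have := (fim v).2 (ex_intro _ a ea); rewrite kv ltnn.
  move=> [a|[]] [b|[]] //= eab; first by rewrite (fI _ _ eab).
  - by case: (nfv a).
  - by case: (nfv b).
have f1im w : key w < m.+1 <-> exists z, f1 z = w.
  rewrite ltnS leq_eqVlt; split.
    case/orP => [/eqP h0|/fim [x <-]]; last by exists (inl x).
    by exists (inr tt); apply: keyI; rewrite kv.
  case=> -[x|x] <- /=; last by rewrite kv eqxx.
  by apply/orP; right; apply/fim; exists x.
have f1k z : key (f1 z) < m.+1 by apply/f1im; exists z.
have tw1 z z' w : llab L1 z = llab L1 z' -> m < key w -> e (f1 z) w = e (f1 z') w.
  case: z z' => [a|[]] [b|[]] //= ll mw.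
  - by apply: ft => //; apply: ltnW.
  - by have := fl a; rewrite ll /= ltnn.
  - by have := fl b; rewrite -ll /= ltnn.
exists L4; split=> //; exists (f1 \o h); split.
- by apply: inj_comp => //; exact: bij_inj.
- move=> w; rewrite f1im; case: bh => h' hK h'K.
  split=> [[z <-]|[x <-]]; last by exists (h x).
  by exists (h' z); rewrite /= h'K.
- move=> x y; rewrite e4 e3 e2.
  rewrite -[h2 (h3 (h4 x))]/(h x) -[h2 (h3 (h4 y))]/(h y).
  rewrite -[(f1 \o h) x]/(f1 (h x)) -[(f1 \o h) y]/(f1 (h y)).
  have mem a : (llab L a \in J) = e (f a) v.
    rewrite inE; apply/existsP/idP => [[x0 /andP[/eqP h0 h1]]|h0].
      by rewrite (ft a x0) // ?kv //.
    by exists a; rewrite eqxx.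
  have nei a : (llab L a == i0) = false.
    by apply/eqP => h0; have := fl a; rewrite h0 /= ltnn.
  case: (h x) => [a|[]]; case: (h y) => [b|[]] /=.
  + by rewrite !nei andbF /= orbF fe.
  + by rewrite eqxx (mem a) nei !andbT orbF.
  + by rewrite eqxx (mem b) nei /= andbF /= esym.
  + by rewrite eqxx (negPf i0J) eirr.
- by move=> x; rewrite ll4.
- move=> x y z exy mz.
  have : kap (f1 (odflt (h x) [pick z : lV L1 | llab L1 z == llab L1 (h x)])) =
    kap (f1 (odflt (h y) [pick z : lV L1 | llab L1 z == llab L1 (h y)])).
    by apply/val_inj; move: (ll4 x); rewrite exy ll4 => /= ->.
  case: pickP => [u /eqP hu|/(_ (h x))] /=; last by rewrite eqxx.
  case: pickP => [u' /eqP hu'|/(_ (h y))] /=; last by rewrite eqxx.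
  move=> ek.
  rewrite -(tw1 _ _ _ hu mz) -(tw1 _ _ _ hu' mz); apply: hkap ek.
  + by rewrite inE f1k.
  + by rewrite inE f1k.
  + by rewrite inE -leqNgt.
Qed.

End Linear.

Lemma linear_cw k (G : graph) (key : gV G -> nat) :
  injective key -> (forall m, cut_le k (gadj G) [set x | key x < m]) ->
  cw_le (k.+1 + k) G.
Proof.
move=> keyI cuts.
case: (linear_prefix (@gadj_sym G) (@gadj_irr G) keyI cuts (\max_v key v).+1) => [h|].
  left; apply/eqP; rewrite -leqn0 leqNgt; apply/negP => /card_gt0P[v _].
  by have := h v; rewrite ltnNge (leq_bigmax v).
case=> L [cL [f [fI fim fe _ _]]]; right; exists L; split=> //; exists f; split=> //.
have fs v : {x | f x == v}.
  by apply: sigW; have [x <-] := (fim v).1 (leq_bigmax v); exists x.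
exists (fun v => sval (fs v)) => [x|v]; first by apply: fI; exact/eqP/(svalP (fs _)).
exact/eqP/(svalP (fs v)).
Qed.

(** * Graphs drawn in a grid *)

(** Meant for columns of opposite parity, whose distance is 1 or at least 3; only there are exactly
    one of the two comparisons true for distinct rows. *)
Definition zlt (c r c' r' : nat) := (c.+1 < c') || ((c <= c'.+1) && (r < r')).

(** The flag [t] makes the odd side a clique: [false] leads to bichain graphs and [true] to split
    permutation graphs, so most of the proof is done once for both. *)
Definition zadj (t : bool) (c r c' r' : nat) :=
  if odd c == odd c' then t && odd c
  else if odd c then zlt c' r' c r else zlt c r c' r'.

Lemma zadj_sym t c r c' r' : zadj t c r c' r' = zadj t c' r' c r.
Proof. by rewrite /zadj eq_sym; case: (odd c); case: (odd c'). Qed.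

Section ZGraph.
Variables (t : bool) (V : finType) (col row : V -> nat).
Definition zrel : rel V := fun u v => (u != v) && zadj t (col u) (row u) (col v) (row v).
Lemma zrel_sym : symmetric zrel.
Proof. by move=> u v; rewrite /zrel eq_sym zadj_sym. Qed.
Lemma zrel_irr : irreflexive zrel.
Proof. by move=> u; rewrite /zrel eqxx. Qed.
Definition zgraph := Graph zrel_sym zrel_irr.
End ZGraph.

(** Positive rows keep the vertices away from the centre of the permutation drawing built in
    [zclass_split_permutation]. *)
Definition zrep t (G : graph) (col row : gV G -> nat) : Prop :=
  [/\ injective row, forall v, 0 < row v &
      forall u v, gadj G u v = zrel t col row u v].

Definition zclass t : graph_class := fun G => exists col row, @zrep t G col row.

Lemma zclass_hereditary t : hereditary (zclass t).
Proof.
move=> G H [col [row [rI rp ga]]] [f [fI fa]].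
exists (col \o f), (row \o f); split.
- exact: inj_comp.
- by move=> v /=.
- by move=> u v; rewrite fa ga /zrel (inj_eq fI).
Qed.

Lemma zgraph_zclass t (V : finType) (col row : V -> nat) :
  injective row -> (forall v, 0 < row v) -> zclass t (zgraph t col row).
Proof. by move=> rI rp; exists col, row. Qed.

Lemma zgraph_sub t (G : graph) (col row : gV G -> nat)
    (U : finType) (ucol urow : U -> nat) (g : U -> gV G) :
  zrep t col row -> injective g ->
  (forall u v, u != v -> zadj t (ucol u) (urow u) (ucol v) (urow v)
    = zadj t (col (g u)) (row (g u)) (col (g v)) (row (g v))) ->
  induced_sub (zgraph t ucol urow) G.
Proof.
move=> [rI rp ga] gI h; exists g; split=> // u v.
rewrite /= ga /zrel (inj_eq gI); case: (altP (u =P v)) => //= uv; exact: h.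
Qed.

(** Each row is tilted down to the right, which makes the rows of the vertices distinct and fixes
    the comparison of horizontal neighbours. *)
Definition grid_graph t n :=
  @zgraph t ('I_n * 'I_n)%type (fun x => x.1) (fun x => x.2 * n + (n - x.1)).

Definition spiral t n := @zgraph t 'I_n (fun i => i) (fun i => n - i).

Lemma grid_row_inj n : injective (fun x : 'I_n * 'I_n => x.2 * n + (n - x.1)).
Proof.
move=> [i j] [i' j'] /= h.
have hi := ltn_ord i; have hi' := ltn_ord i'.
have ej : j = j' :> nat.
  have [jj|jj|//] := ltngtP j j'.
  - by have := leq_mul jj (leqnn n); rewrite mulSn; lia.
  - by have := leq_mul jj (leqnn n); rewrite mulSn; lia.
by congr pair; apply: val_inj => //=; move: h; rewrite ej; lia.
Qed.

Lemma grid_graph_zclass t n : zclass t (grid_graph t n).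
Proof.
apply: zgraph_zclass; first exact: grid_row_inj.
by move=> [i j] /=; have := ltn_ord i; lia.
Qed.

Lemma spiral_zclass t n : zclass t (spiral t n).
Proof.
apply: zgraph_zclass => [i j h|i]; last by rewrite subn_gt0.
by apply: val_inj => /=; have := ltn_ord i; have := ltn_ord j; lia.
Qed.

Lemma grid_row_lt n (i i' j j' : 'I_n) :
  (j * n + (n - i) < j' * n + (n - i')) = (j < j') || (j == j') && (i' < i).
Proof.
have hi := ltn_ord i; have hi' := ltn_ord i'.
rewrite -(inj_eq val_inj) /=.
have [jj|jj|->] := ltngtP j j' => /=; last by lia.
- by have := leq_mul jj (leqnn n); rewrite mulSn; lia.
- by have := leq_mul jj (leqnn n); rewrite mulSn; lia.
Qed.

(** Since [row] is injective, distinct vertices land in distinct rows of the grid, so the tilt never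
    decides a comparison. *)
Lemma zclass_sub_grid t G : zclass t G -> exists N, forall n, N <= n -> induced_sub G (grid_graph t n).
Proof.
move=> [col [row [rI rp ga]]].
exists (maxn (\max_v col v) (\max_v row v)).+1 => n hn.
have hc v : col v < n by have := leq_bigmax (F := col) v; lia.
have hr v : row v < n by have := leq_bigmax (F := row) v; lia.
exists (fun v => (Ordinal (hc v), Ordinal (hr v))); split.
  by move=> u v [_ /rI].
move=> u v; rewrite ga /= /zrel xpair_eqE -!(inj_eq val_inj) /= (inj_eq rI).
case: (altP (u =P v)) => [->|uv] /=; first by rewrite !eqxx.
rewrite andbF /= /zadj.
have key x y : x != y -> odd (col x) != odd (col y) -> zlt (col x) (row x) (col y) (row y) =
  zlt (col x) (row x * n + (n - col x)) (col y) (row y * n + (n - col y)).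
  move=> xy o; rewrite /zlt.
  have := grid_row_lt (Ordinal (hc x)) (Ordinal (hc y)) (Ordinal (hr x)) (Ordinal (hr y)).
  by rewrite -(inj_eq val_inj) /= => ->; rewrite (inj_eq rI) (negPf xy) /= orbF.
case: ifP => // /negbT o; rewrite !key //; first by rewrite eq_sym.
by rewrite eq_sym.
Qed.

(** Each side is divided by its columns modulo 4. Two congruent columns are equal or at least four
    apart, so no column is next to both, and ordering by column and then row nests the
    neighbourhoods. *)
Lemma zclass_bichain G : zclass false G -> bichain G.
Proof.
move=> [col [row [rI rp ga]]].
have dj (P Q : pred (gV G)) : (forall x, Q x = ~~ P x) -> [set x | P x] :|: [set x | Q x] = setT /\
   [disjoint [set x | P x] & [set x | Q x]].
  move=> h; split; first by apply/setP => x; rewrite !inE h orbN.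
  by rewrite -setI_eq0; apply/eqP/setP => x; rewrite !inE h andbN.
have two o : two_chains [set x : gV G | odd (col x) == o].
  have half b : is_chain [set x : gV G | (odd (col x) == o) && (odd (col x)./2 == b)].
    move=> x y; rewrite !inE => /andP[/eqP ox /eqP bx] /andP[/eqP oy /eqP by_].
    have four : col x = col y \/ col x + 4 <= col y \/ col y + 4 <= col x by lia.
    case: o ox oy => ox oy; last first.
    + case: (boolP ((col x < col y) || (col x == col y) && (row x <= row y))) => h; apply/orP; [right|left];
      apply/subsetP => w; rewrite !inE !ga /zrel /zadj ?ox ?oy /=; case ow: (odd (col w)) => /=; rewrite ?andbF //;
      move=> /andP[_ z]; (apply/andP; split; [by apply/eqP => e; move: ow; rewrite -e ?ox ?oy|]);
      move: z; rewrite /zlt; lia.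
    + case: (boolP ((col x < col y) || (col x == col y) && (row x <= row y))) => h; apply/orP; [left|right];
      apply/subsetP => w; rewrite !inE !ga /zrel /zadj ?ox ?oy /=; case ow: (odd (col w)) => /=; rewrite ?andbF //;
      move=> /andP[_ z]; (apply/andP; split; [by apply/eqP => e; move: ow; rewrite -e ?ox ?oy|]);
      move: z; rewrite /zlt; lia.
  exists [set x : gV G | (odd (col x) == o) && (odd (col x)./2 == true)],
         [set x : gV G | (odd (col x) == o) && (odd (col x)./2 == false)].
  split; last by split; apply: half.
  by apply/setP => x; rewrite !inE; case: (odd (col x) == o); case: (odd _./2).
have ind o : independent [set x : gV G | odd (col x) == o].
  move=> x y; rewrite !inE ga /zrel /zadj => /eqP -> /eqP ->.
  by rewrite eqxx /= andbF.
exists [set x : gV G | odd (col x) == false], [set x : gV G | odd (col x) == true].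
have [|h1 h2] := dj (fun x => odd (col x) == false) (fun x => odd (col x) == true).
  by move=> x; case: (odd _).
by split.
Qed.

Lemma block_lt M a b r s : r < M -> s < M ->
  (a * M + r < b * M + s) = (a < b) || (a == b) && (r < s).
Proof.
move=> hr hs; have [h|h|->] := ltngtP a b => /=; last by rewrite ltn_add2l.
- by have := leq_mul h (leqnn M); rewrite mulSn; lia.
- by have := leq_mul h (leqnn M); rewrite mulSn; lia.
Qed.

(* The columns wind around a centre: the column mod 4 is the quadrant of a vertex,
   and [h], [w] are its horizontal and vertical distances to the centre. *)
Lemma zclass_split_permutation G : zclass true G -> split_permutation G.
Proof.
move=> [col [row [rI rp ga]]]; split.
  exists [set x : gV G | odd (col x)], [set x : gV G | ~~ odd (col x)]; split.
  - by apply/setP => x; rewrite !inE orbN.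
  - by rewrite -setI_eq0; apply/eqP/setP => x; rewrite !inE andbN.
  - by move=> x y; rewrite !inE ga /zrel /zadj => hx hy ->; rewrite hx hy.
  - by move=> x y; rewrite !inE ga /zrel /zadj => /negPf hx /negPf hy; rewrite hx hy /= andbF.
pose M := (\max_v row v).+1; pose N := (\max_v col v).+1.
have hr v : row v < M by rewrite ltnS; apply: (leq_bigmax (F := row) v).
have hc v : col v < N by rewrite ltnS; apply: (leq_bigmax (F := col) v).
pose h v := (col v)./2 * M + row v; pose w v := (uphalf (col v)) * M + row v.
pose C := N.+1 * M.
have hC v : 0 < h v < C.
  rewrite /h /C mulSn addn_gt0 rp orbT /=.
  have : (col v)./2 * M <= N * M by rewrite leq_mul2r; have := hc v; lia.
  by have := hr v; lia.
have wC v : 0 < w v < C.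
  rewrite /w /C mulSn addn_gt0 rp orbT /=.
  have : uphalf (col v) * M <= N * M by rewrite leq_mul2r; have := hc v; lia.
  by have := hr v; lia.
have hlt u v : (h u < h v) = ((col u)./2 < (col v)./2) || ((col u)./2 == (col v)./2) && (row u < row v).
  exact: block_lt.
have wlt u v : (w u < w v) = (uphalf (col u) < uphalf (col v)) || (uphalf (col u) == uphalf (col v)) && (row u < row v).
  exact: block_lt.
have tri (f : gV G -> nat) (k : gV G -> nat) :
   (forall u v, (f u < f v) = (k u < k v) || (k u == k v) && (row u < row v)) ->
   forall u v, f u = f v -> u = v.
  move=> hf u v e; apply: rI; have := hf u v; have := hf v u; rewrite e ltnn; lia.
have hI : injective h by apply: (tri h (fun u => (col u)./2)).
have wI : injective w by apply: (tri w (fun u => uphalf (col u))).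
pose P v := if odd (col v)./2 then C + h v else C - h v.
pose Q v := if odd (uphalf (col v)) then C + w v else C - w v.
exists P, Q; split.
- move=> u v; rewrite /P => e; apply: hI; move: e.
  by have := hC u; have := hC v; case: (odd _); case: (odd _); lia.
- move=> u v; rewrite /Q => e; apply: wI; move: e.
  by have := wC u; have := wC v; case: (odd _); case: (odd _); lia.
move=> u v uv; rewrite ga /zrel uv /=.
have ruv : row u <> row v by move/rI => e; rewrite e eqxx in uv.
have PE : (P u < P v) = match odd (col u)./2, odd (col v)./2 with
  | true, true => h u < h v | false, false => h v < h u | true, false => false | false, true => true end.
  by rewrite /P; have := hC u; have := hC v; case: (odd _); case: (odd _); lia.
have QE : (Q u < Q v) = match odd (uphalf (col u)), odd (uphalf (col v)) with
  | true, true => w u < w v | false, false => w v < w u | true, false => false | false, true => true end.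
  by rewrite /Q; have := wC u; have := wC v; case: (odd _); case: (odd _); lia.
rewrite PE QE !hlt !wlt /zadj /zlt {PE QE}.
case: (boolP (odd (col u)./2)) => e1; case: (boolP (odd (uphalf (col u)))) => e2;
case: (boolP (odd (col v)./2)) => e3; case: (boolP (odd (uphalf (col v)))) => e4;
case: (boolP (odd (col u))) => e5; case: (boolP (odd (col v))) => e6 /=; lia.
Qed.

(** * Breadth-first layerings *)

(** Here [rho] is one plus the distance to [x0] along predecessors inside [W], and 0 for unreached
    vertices; it is the [fix_order] of the operator adding predecessors. *)
Lemma bfs_rank (V : finType) (e : rel V) (W : {set V}) (x0 : V) : x0 \in W ->
  exists rho : V -> nat,
    [/\ forall y, (rho y == 1) = (y == x0), forall y, 0 < rho y -> y \in W,
        forall y x, y \in W -> 0 < rho x -> e y x -> 0 < rho y <= (rho x).+1 &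
        forall y, 1 < rho y -> exists x, (rho x).+1 = rho y /\ e y x].
Proof.
move=> x0W.
pose F (X : {set V}) := x0 |: [set y in W | [exists x in X, e y x]].
have Fm : {homo F : X Y / X \subset Y}.
  move=> X Y sXY; apply/setUS/subsetP => y; rewrite !inE => /andP[-> /exists_inP[x xX eyx]] /=.
  by apply/exists_inP; exists x => //; apply: (subsetP sXY).
pose rho := fix_order F.
have x0r : rho x0 = 1.
  apply/eqP; rewrite eqn_leq (fix_order_small Fm) ?setU11 //=.
  by rewrite fix_order_gt0 // -fixsetK // setU11.
have step y x : y \in W -> 0 < rho x -> e y x -> 0 < rho y <= (rho x).+1.
  move=> yW; rewrite fix_order_gt0 // => xf eyx; rewrite -in_iter_fixE //= !inE yW /=.
  by apply/orP; right; apply/exists_inP; exists x => //; rewrite in_iter_fix_orderE.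
have pred y : 0 < rho y -> y = x0 \/ exists x, (rho x).+1 = rho y /\ e y x.
  move=> y0; have := y0; rewrite fix_order_gt0 // -in_iter_fix_orderE //.
  rewrite -/(rho y) -(prednK y0) /= !inE => /orP[/eqP|/andP[yW /exists_inP[x xi eyx]]]; first by left.
  right; exists x; split=> //.
  move: xi; rewrite in_iter_fixE // -/(rho x) => /andP[x1 x2].
  by have := step _ _ yW x1 eyx; lia.
exists rho; split=> //.
- move=> y; apply/eqP/eqP => [y1|->] //.
  case: (pred y) => [|//|[x [ex eyx]]]; first by rewrite y1.
  move: ex; rewrite y1 => -[rx]; have := y1.
  have : y \in iter 1 F set0 by rewrite in_iter_fixE // -/(rho y) y1.
  rewrite /= !inE => /orP[/eqP //|/andP[_ /exists_inP[z]]]; by rewrite inE.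
- move=> y; rewrite fix_order_gt0 // -fixsetK // !inE => /orP[/eqP->//|/andP[]//].
- move=> y y1; case: (pred y) => [|yx|//]; first exact: ltnW.
  by move: y1; rewrite yx x0r.
Qed.

(** The hypothesis is acyclicity, stated as the existence of minimal elements; they are removed one
    after another. *)
Lemma linear_extension (V : finType) (e : rel V) :
  (forall W : {set V}, W != set0 -> exists2 u, u \in W & forall w, w \in W -> ~~ e w u) ->
  exists row : V -> nat, [/\ injective row, forall v, 0 < row v & forall u v, e u v -> row u < row v].
Proof.
move=> hmin.
suff H n (W : {set V}) : #|W| <= n -> exists row : V -> nat,
    [/\ {in W &, injective row}, forall v, 0 < row v & {in W &, forall u v, e u v -> row u < row v}].
  have [row [h1 h2 h3]] := H _ [set: V] (leqnn _).
  by exists row; split=> // [u v|u v]; [apply: h1|apply: h3].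
elim: n W => [|n IH] W hW.
  have W0 : W = set0 by apply/eqP; rewrite -cards_eq0 -leqn0.
  by exists (fun _ => 1); split=> // u v; rewrite W0 inE.
have [W0|/hmin [u uW hu]] := eqVneq W set0.
  by exists (fun _ => 1); split=> // u v; rewrite W0 inE.
have [row [h1 h2 h3]] : exists row : V -> nat,
    [/\ {in W :\ u &, injective row}, forall v, 0 < row v & {in W :\ u &, forall u v, e u v -> row u < row v}].
  by apply: IH; move: hW; rewrite (cardsD1 u) uW.
exists (fun v => if v == u then 1 else (row v).+1); split.
- move=> v w vW wW; have [->|vu] := eqVneq v u; have [->|wu] := eqVneq w u => //.
  + by have := h2 w; lia.
  + by have := h2 v; lia.
  + by move=> [] e'; apply: h1 => //; rewrite in_setD1 ?vu ?wu.
- by move=> v; case: ifP.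
- move=> v w vW wW; have [->|vu] := eqVneq v u; have [->|wu] := eqVneq w u => //.
  + by rewrite (negPf (hu _ uW)).
  + by have := h2 w; lia.
  + by rewrite (negPf (hu _ vW)).
  + by move=> evw; rewrite ltnS; apply: h3 => //; rewrite in_setD1 ?vu ?wu.
Qed.

Section Layers.
Variables (V : finType) (sg cl : V -> bool) (lt : rel V).
Hypothesis lt_opp : forall u v, lt u v -> sg u != sg v.
Hypothesis lt_tot : forall u v, sg u != sg v -> lt u v = ~~ lt v u.
Hypothesis chain : forall u v, sg u = sg v -> cl u = cl v ->
  (forall w, lt w u -> lt w v) \/ (forall w, lt w v -> lt w u).

Lemma lt_asym u v : lt u v -> lt v u = false.
Proof. by move=> h; rewrite lt_tot ?h // eq_sym lt_opp. Qed.

(** Predecessor sets in one chain are nested, so one of least cardinality is contained in all the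
    others. *)
Lemma chain_min (P : pred V) u : P u -> (forall v, P v -> sg v = sg u /\ cl v = cl u) ->
  exists2 m, P m & forall z w, P z -> lt w m -> lt w z.
Proof.
move=> Pu Pc.
case: (@arg_minnP _ u P (fun m => #|[set w | lt w m]|) Pu) => m Pm hm.
exists m => // z w Pz.
have [sz cz] := Pc _ Pz; have [sm cm] := Pc _ Pm.
case: (chain (u := m) (v := z)) => [||h|h]; rewrite ?sz ?cz //; first exact: h.
have sub : [set w | lt w z] \subset [set w | lt w m] by apply/subsetP => y; rewrite !inE; apply: h.
have /eqP/setP/(_ w) : [set w | lt w z] == [set w | lt w m] by rewrite eqEcard sub hm.
by rewrite !inE => ->.
Qed.

(** Let [x] have the least predecessor set of its chain. If its predecessors meet both classes, let
    [y] be least in the chain of a predecessor of class [false]. Then [y] precedes [x], hence by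
    minimality of [x] the whole chain of [x], so the predecessors of [y] all lie in the other
    class. *)
Lemma start_vertex (W : {set V}) : W != set0 -> exists x0 d, [/\ x0 \in W,
  forall z w, z \in W -> sg z = sg x0 -> cl z = cl x0 -> lt w x0 -> lt w z &
  forall y, y \in W -> lt y x0 -> cl y = d].
Proof.
case/set0Pn => u uW.
have [||x /andP[xW xc] xm] := @chain_min (fun v => (v \in W) && ((sg v == sg u) && (cl v == cl u))) u.
- by rewrite uW !eqxx.
- by move=> v /andP[_ /andP[/eqP -> /eqP ->]].
move: xc => /andP[/eqP sx /eqP cx].
have xm' z w : z \in W -> sg z = sg x -> cl z = cl x -> lt w x -> lt w z.
  by move=> zW sz cz; apply: xm; rewrite zW sz cz sx cx !eqxx.
case: (boolP [forall y in W, lt y x ==> (cl y == true)]) => [/forall_inP h|].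
  by exists x, true; split=> // y yW lyx; apply/eqP; move: (h y yW); rewrite lyx.
rewrite negb_forall_in => /exists_inP[w wW]; rewrite negb_imply => /andP[wx cw].
have [||y /andP[yW yc] ym] := @chain_min (fun v => (v \in W) && ((sg v == sg w) && (cl v == cl w))) w.
- by rewrite wW !eqxx.
- by move=> v /andP[_ /andP[/eqP -> /eqP ->]].
move: yc => /andP[/eqP sy /eqP cy].
have yx : lt y x.
  rewrite lt_tot ?sy ?lt_opp //; apply/negP => h.
  by have := ym w x; rewrite wW !eqxx => /(_ isT h); rewrite lt_asym.
exists y, (~~ cl x); split=> //.
  by move=> z v zW sz cz; apply: ym; rewrite zW sz cz sy cy !eqxx.
move=> z zW zy; case: (eqVneq (cl z) (cl x)) => [e|]; last by case: (cl z); case: (cl x).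
have sz : sg z = sg x.
  by have := lt_opp zy; have := lt_opp yx; case: (sg z); case: (sg y); case: (sg x).
by have := xm' _ _ zW sz e yx; rewrite lt_asym.
Qed.

(** A piece is what the search reaches from a start vertex. No unreached vertex precedes a reached
    one, so the piece precedes the rest, and the induction continues there. *)
Lemma layering (W : {set V}) : exists piece lay : V -> nat,
  [/\ {in W, forall u, odd (lay u) = sg u},
      {in W &, forall u v, piece u < piece v -> sg u != sg v -> lt u v},
      {in W &, forall u v, piece u = piece v -> (lay u).+1 < lay v -> sg u != sg v -> lt u v},
      {in W &, forall u v, piece u = piece v -> lay u = lay v -> cl u = cl v} &
      {in W, forall u, 1 < lay u ->
         exists v, [/\ v \in W, piece v = piece u, (lay v).+1 = lay u & lt u v]}].
Proof.
have [n] := ubnP #|W|; elim: n W => // n IH W; rewrite ltnS => hn.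
have [->|W0] := eqVneq W set0.
  by exists (fun _ => 0), (fun _ => 0); split=> [u|u v|u v|u v|u]; rewrite inE.
have [x0 [d [x0W x0m x0d]]] := start_vertex W0.
have [rho [r1 rW rs rp]] := bfs_rank lt x0W.
(* The class of the layer with rank [i]: on each side the two classes alternate, starting from
   [cl x0] and from [d]. *)
pose kc i := (if odd i then cl x0 else d) (+) odd (i.-1)./2.
have kcS i : kc i.+3 = ~~ kc i.+1 by rewrite /kc /= negbK addbN.
have cls i y : rho y = i.+1 -> cl y = kc i.+1 /\ sg y = sg x0 (+) odd i.
  elim/ltn_ind: i y => -[|[|i]] IHi y ry.
  - have /eqP -> : y == x0 by rewrite -r1 ry.
    by rewrite /kc /= !addbF.
  - case: (rp y) => [|x]; rewrite ry // => -[[] /eqP]; rewrite r1 => /eqP -> yx.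
    have yW : y \in W by apply: rW; rewrite ry.
    rewrite /kc /= addbF (x0d _ yW yx); split=> //.
    by have := lt_opp yx; case: (sg y); case: (sg x0).
  - case: (rp y) => [|x]; rewrite ry // => -[[] rx yx].
    case: (rp x) => [|x']; rewrite rx // => -[[] rx' xx'].
    have yW : y \in W by apply: rW; rewrite ry.
    have [cx' sx'] := IHi i (leqnSn i.+1) x' rx'.
    have sy : sg y = sg x'.
      by have := lt_opp yx; have := lt_opp xx'; case: (sg y); case: (sg x); case: (sg x').
    split; last by rewrite sy sx' /= negbK.
    rewrite kcS -cx' //; case: (eqVneq (cl y) (cl x')) => [cy|]; last by case: (cl y); case: (cl x').
    (* Suppose [y] and [x'], two layers apart, share a class. If [x'] is the start vertex, its
       minimality puts [x] before [y]. Otherwise the predecessors of [y] are among those of [x'], so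
       [y] precedes [x''] and would have been reached earlier. *)
    exfalso; case: i ry rx rx' IHi cx' sx' => [|i] ry rx rx' IHi cx' sx'.
      move: rx' => /eqP; rewrite r1 => /eqP e0; rewrite e0 in xx' sy cy.
      by have := x0m _ _ yW sy cy xx'; rewrite lt_asym.
    case: (rp x') => [|x'']; rewrite rx' // => -[[] rx'' x'x''].
    have h : forall w, lt w y -> lt w x'.
      by case: (chain sy cy) => // h; have := h _ xx'; rewrite (lt_asym yx).
    have yx'' : lt y x''.
      rewrite lt_tot ?sy ?lt_opp //; apply/negP => /h; by rewrite (lt_asym x'x'').
    by have := rs _ _ yW _ yx''; rewrite rx'' ry => /(_ isT); clear; lia.
have cls' y : 0 < rho y -> cl y = kc (rho y) /\ sg y = sg x0 (+) odd (rho y).-1.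
  by case e: (rho y) => [//|i] _; apply: cls.
pose R := [set y in W | rho y == 0].
have [|piece [lay [l1 l2 l3 l4 l5]]] := IH R.
  apply: leq_trans hn; apply: proper_card; apply/properP; split.
    by apply/subsetP => y; rewrite inE => /andP[].
  by exists x0 => //; rewrite inE x0W /=; have := r1 x0; rewrite eqxx => /eqP ->.
have inR y : y \in W -> (y \in R) = (rho y == 0) by rewrite inE => ->.
(* Adding [sg x0] makes the parity of a layer agree with its side, so a piece starts in layer 0 or
   1. *)
exists (fun y => if 0 < rho y then 0 else (piece y).+1),
       (fun y => if 0 < rho y then (rho y).-1 + sg x0 else lay y).
have inR' y : y \in W -> (0 < rho y) = false -> y \in R.
  by move=> yW; rewrite inR //; case: (rho y).
split=> [u uW|u v uW vW|u v uW vW|u v uW vW|u uW].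
- case: ifP => h; last by apply: l1; apply: inR'.
  by rewrite oddD oddb addbC; case: (cls' _ h).
- case: ifP => hu; case: ifP => hv //; last first.
    by rewrite ltnS => h s; apply: l2 => //; apply: inR'.
  move=> _ s; rewrite lt_tot //; apply/negP => /(rs _ _ vW hu).
  by rewrite hv.
- case: ifP => hu; case: ifP => hv //; last first.
    by case=> h1 h2 s; apply: l3 => //; apply: inR'.
  move=> _ h s; rewrite lt_tot //; apply/negP => /(rs _ _ vW hu); lia.
- case: ifP => hu; case: ifP => hv //; last first.
    by case=> h1 h2; apply: l4 => //; apply: inR'.
  move=> _ h; have [-> _] := cls' _ hu; have [-> _] := cls' _ hv; congr kc; lia.
- case: ifP => hu h; last first.
    have [v [vR pv lv ltv]] := l5 u (inR' _ uW hu) h.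
    move: vR; rewrite inE => /andP[vW /eqP rv]; exists v.
    by rewrite rv /= pv.
  have [|v [rv ltv]] := rp u; first by case: (sg x0) h; lia.
  have rv0 : 0 < rho v.
    by case: (sg x0) h => h; lia.
  exists v; rewrite rv0; split=> //; [exact: rW|lia].
Qed.

(** Rows only have to respect [lt] between neighbouring layers of one piece, so a linear extension
    of that relation suffices once it is shown acyclic. *)
Lemma layered_structure : exists piece lay row : V -> nat,
  [/\ injective row, forall v, 0 < row v, forall v, odd (lay v) = sg v,
      forall u v, sg u != sg v -> lt u v = (piece u < piece v) ||
         (piece u == piece v) && zlt (lay u) (row u) (lay v) (row v) &
      forall u, 1 < lay u -> exists v, [/\ piece v = piece u, (lay v).+1 = lay u & lt u v]].
Proof.
have [piece [lay [l1 l2 l3 l4 l5]]] := layering setT.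
pose e u v := [&& lt u v, piece u == piece v & (lay u == (lay v).+1) || (lay v == (lay u).+1)].
have [W /set0Pn[u0 u0W]|row [rI rp re]] := @linear_extension V e.
  case: (boolP [exists u in W, [forall w in W, ~~ e w u]]) => [/exists_inP[u uW /forall_inP h]|].
    by exists u.
  rewrite negb_exists_in => /forall_inP no; exfalso.
  have hno u : u \in W -> exists2 w, w \in W & e w u.
    by move/no; rewrite negb_forall_in => /exists_inP[w wW]; rewrite negbK; exists w.
  have lmin m : m \in W -> exists m', [/\ m' \in W, piece m' = piece m, lay m' = lay m &
      forall z w, z \in W -> piece z = piece m -> lay z = lay m -> lt w m' -> lt w z].
    move=> mW.
    have [||m' /and3P[m'W /eqP pm' /eqP lm'] hm'] :=
       @chain_min (fun v => [&& v \in W, piece v == piece m & lay v == lay m]) m.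
    - by rewrite mW !eqxx.
    - move=> v /and3P[vW /eqP pv /eqP lv]; split; last by apply: l4; rewrite ?inE.
      by rewrite -!l1 ?inE // lv.
    exists m'; split=> // z w zW pz lz; apply: hm'; by rewrite zW pz lz !eqxx.
  (* In a set without minimal element, a least vertex of layer [l] whose predecessors all lie in
     layer [l.+1] yields such a vertex in layer [l.+1]. Starting from the lowest layer, this would
     exceed every layer. *)
  pose Pmin l := exists u, [/\ u \in W, lay u = l,
     forall z w, z \in W -> piece z = piece u -> lay z = lay u -> lt w u -> lt w z &
     forall w, w \in W -> e w u -> lay w = l.+1].
  have step l : Pmin l -> Pmin l.+1.
    case=> u [uW lu mu hu]; have [w wW wu] := hno _ uW.
    have lw := hu _ wW wu; case/and3P: wu => wu /eqP pw _.
    have [m [mW pm lm hm]] := lmin w wW.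
    have ltmu : lt m u.
      rewrite lt_tot; last by rewrite -!l1 ?inE // lm lw lu /= ; case: (odd l).
      apply/negP => h; have := hm w u wW erefl erefl h; by rewrite (lt_asym wu).
    exists m; split=> //; first by rewrite lm.
      by rewrite pm lm.
    move=> x xW /and3P[xm /eqP px]; rewrite lm lw => /orP[/eqP //|/eqP [lx]].
    by have := mu x m xW; rewrite px pm pw -lx lu (lt_asym xm) => /(_ erefl erefl ltmu).
  case: (@arg_minnP _ u0 (mem W) lay u0W) => u1 u1W hu1.
  have base : Pmin (lay u1).
    have [m [mW pm lm hm]] := lmin u1 u1W.
    exists m; split=> // [|w wW /and3P[_ _]]; first by rewrite pm lm.
    by rewrite lm => /orP[/eqP //|/eqP e1]; have := hu1 _ wW; rewrite e1 ltnn.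
  have big k : Pmin (lay u1 + k).
    by elim: k => [|k IHk]; rewrite ?addn0 // addnS; apply: step.
  have [u [_ lu _ _]] := big (\max_v lay v).+1.
  by have := leq_bigmax (F := lay) u; rewrite lu; lia.
exists piece, lay, row; split=> // [v|u v s|u u1]; first by apply: l1; rewrite inE.
- have [h|h|h] := ltngtP (piece u) (piece v) => /=.
  + by apply: l2; rewrite ?inE.
  + by rewrite lt_tot // l2 ?inE // eq_sym.
  rewrite /zlt.
  have par : odd (lay u) != odd (lay v) by rewrite !l1 ?inE.
  have [h1|h1] := ltnP (lay u).+1 (lay v); first by apply: l3; rewrite ?inE.
  rewrite /=; have [h2|h2] := leqP (lay u) (lay v).+1 => /=; last first.
    by rewrite lt_tot // l3 ?inE // eq_sym.
  have adj : (lay u == (lay v).+1) || (lay v == (lay u).+1).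
    by move: par h1 h2; clear; lia.
  apply/idP/idP => [luv|]; first by apply: re; rewrite /e luv h eqxx.
  apply: contraTT; rewrite -leqNgt => luv; rewrite leq_eqVlt re ?orbT //.
  by rewrite /e lt_tot ?luv 1?eq_sym // h eqxx /= orbC.
- have [||v [_ pv lv luv]] := l5 u; rewrite ?inE //; by exists v.
Qed.
End Layers.

(** * Layered drawings of bichain graphs and split permutation graphs *)

Definition slt (V : finType) (piece lay row : V -> nat) (u v : V) :=
  (piece u < piece v) || (piece u == piece v) && zlt (lay u) (row u) (lay v) (row v).

(** A drawing as a sequence of pieces. The last clause remembers the breadth-first search; spirals
    are extracted from it. *)
Definition srep t (G : graph) (piece lay row : gV G -> nat) : Prop :=
  [/\ injective row, forall v, 0 < row v,
      forall u v, gadj G u v = (u != v) &&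
        (if odd (lay u) == odd (lay v) then t && odd (lay u)
         else if odd (lay u) then slt piece lay row v u else slt piece lay row u v) &
      forall u, 1 < lay u -> exists v, [/\ piece v = piece u, (lay v).+1 = lay u & row u < row v]].

(** An even vertex is put before an odd one when they are adjacent, and after it otherwise.
    Predecessors of even vertices are thus non-neighbours, so the inclusions are reversed on that
    side. *)
Lemma cross_chains_srep t (G : graph) (sg cl : gV G -> bool) :
  (forall u v, sg u = sg v -> gadj G u v = [&& u != v, t & sg u]) ->
  (forall u v, sg u = sg v -> cl u = cl v ->
     (forall w, sg w != sg u -> gadj G w u -> gadj G w v) \/
     (forall w, sg w != sg u -> gadj G w v -> gadj G w u)) ->
  exists piece lay row, @srep t G piece lay row.
Proof.
move=> same chain.
pose lt u v := (sg u != sg v) && (if sg u then ~~ gadj G u v else gadj G u v).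
have lt_opp u v : lt u v -> sg u != sg v by case/andP.
have lt_tot u v : sg u != sg v -> lt u v = ~~ lt v u.
  move=> s; rewrite /lt (eq_sym (sg v)) s (gadj_sym v u) /=.
  by case: (sg u) s; case: (sg v) => //= _; rewrite negbK.
have chain' u v : sg u = sg v -> cl u = cl v ->
  (forall w, lt w u -> lt w v) \/ (forall w, lt w v -> lt w u).
  move=> s c; rewrite /lt -s; case: (chain u v s c) => h; case su: (sg u).
  - by left=> w; case sw: (sg w) => //=; apply: h; rewrite su sw.
  - by right=> w; case sw: (sg w) => //=; apply: contra; apply: h; rewrite su sw.
  - by right=> w; case sw: (sg w) => //=; apply: h; rewrite su sw.
  - by left=> w; case sw: (sg w) => //=; apply: contra; apply: h; rewrite su sw.
have [piece [lay [row [rI rp ol lE bfs]]]] := layered_structure lt_opp lt_tot chain'.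
exists piece, lay, row; split=> //.
- move=> u v; rewrite !ol; case: (altP (sg u =P sg v)) => s; first by rewrite same.
  have uv : u != v by apply: contra s => /eqP ->.
  have su : sg v = ~~ sg u by move: s; case: (sg u); case: (sg v).
  rewrite uv /= /slt -!lE ?(eq_sym (sg v)) // /lt (eq_sym (sg v)) s su /=.
  by case: (sg u) => //=; rewrite gadj_sym.
- move=> u /bfs [v [pv lv luv]]; exists v; split=> //.
  move: (luv); rewrite lE; last exact: lt_opp.
  by rewrite pv ltnn eqxx /zlt -lv /= ltnNge ltnW // => /andP[].
Qed.

Lemma bichain_srep G : bichain G -> exists piece lay row, @srep false G piece lay row.
Proof.
case=> A [B [AB dAB iA iB [[A1 [A2 [eA [cA1 cA2]]]] [B1 [B2 [eB [cB1 cB2]]]]]]].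
have AB' x : (x \in A) = ~~ (x \in B).
  have := disjointFr dAB (x := x); have : x \in A :|: B by rewrite AB inE.
  by rewrite inE; case: (x \in A); case: (x \in B) => //= _ ->.
have sub (S : {set gV G}) u v : is_chain S -> u \in S -> v \in S ->
    (forall w, gadj G w u -> gadj G w v) \/ (forall w, gadj G w v -> gadj G w u).
  move=> cS uS vS; case/orP: (cS u v uS vS) => /subsetP h; [left|right] => w;
  by have := h w; rewrite !inE !(gadj_sym w).
apply: (@cross_chains_srep _ _ (fun x => x \in B) (fun x => (x \in A1) || (x \in B1))) => u v.
  move=> s; rewrite andbF; apply/negbTE.
  case: (boolP (u \in B)) => uB; first by apply: iB => //; rewrite -s.
  by apply: iA; rewrite AB' -?s.
have sub' (S1 S2 : {set gV G}) : is_chain S1 -> is_chain S2 -> u \in S1 :|: S2 -> v \in S1 :|: S2 ->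
   (u \in S1) = (v \in S1) ->
    (forall w, gadj G w u -> gadj G w v) \/ (forall w, gadj G w v -> gadj G w u).
  move=> c1 c2; rewrite !inE; case u1: (u \in S1) => /=; first by move=> _ _ /esym v1; apply: (sub S1).
  by move=> u2 v2 v1; move: v2; rewrite -v1 /= => v2; apply: (sub S2).
have in1 x : (x \in A1) -> x \notin B by move=> h; rewrite -AB' eA inE h.
have in2 x : (x \in B1) -> x \in B by move=> h; rewrite eB inE h.
move=> s c.
have [h|h] : (forall w, gadj G w u -> gadj G w v) \/ (forall w, gadj G w v -> gadj G w u); last first.
- by right=> w _; apply: h.
- by left=> w _; apply: h.
have [uB|uB] := boolP (u \in B).
  have vB : v \in B by rewrite -s.
  apply: (sub' B1 B2) => //; rewrite -?eB //; move: c.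
  by case: (boolP (u \in A1)) => [/in1|_]; case: (boolP (v \in A1)) => [/in1|_]; rewrite ?uB ?vB.
have vB : v \notin B by rewrite -s.
apply: (sub' A1 A2) => //; rewrite -?eA ?AB' //; move: c.
by case: (boolP (u \in B1)) => [/in2|_]; case: (boolP (v \in B1)) => [/in2|_];
  rewrite ?(negPf uB) ?(negPf vB) ?orbF.
Qed.

(** Plotted by [p] and [q], the independent set is increasing and the clique is decreasing. An
    increasing sequence cannot meet both the upper left and the lower right quadrant of a point, nor
    a decreasing one both the lower left and the upper right. *)
Lemma split_permutation_srep G :
  split_permutation G -> exists piece lay row, @srep true G piece lay row.
Proof.
case=> -[K [I [KI dKI cK iI]]] [p [q [pI qI hG]]].
have IK x : (x \in I) = ~~ (x \in K).
  have := disjointFr dKI (x := x); have : x \in K :|: I by rewrite KI inE.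
  by rewrite inE; case: (x \in K); case: (x \in I) => //= _ ->.
have pn x y : x != y -> p x <> p y by move=> xy /pI e; rewrite e eqxx in xy.
have qn x y : x != y -> q x <> q y by move=> xy /qI e; rewrite e eqxx in xy.
have oI x y : x \notin K -> y \notin K -> p x < p y -> q x < q y.
  move=> xK yK h; have xy : x != y by apply: contraTneq h => ->; rewrite ltnn.
  have := iI x y; rewrite !IK xK yK hG // => /(_ isT isT); have := qn _ _ xy; lia.
have oK x y : x \in K -> y \in K -> p x < p y -> q y < q x.
  move=> xK yK h; have xy : x != y by apply: contraTneq h => ->; rewrite ltnn.
  have := cK x y xK yK xy; rewrite hG //; have := qn _ _ xy; lia.
(* For a clique vertex, [cl] tells which quadrant may hold its independent neighbours; for an
   independent vertex, which one may hold its non-neighbours in the clique. Within a class these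
   quadrants are nested. *)
pose cl x := if x \in K then [exists i, (i \notin K) && ((p x < p i) && (q i < q x))]
             else [exists k, (k \in K) && ((p k < p x) && (q k < q x))].
have adjE w x : (w \in K) != (x \in K) -> gadj G w x = ((p w < p x) != (q w < q x)).
  by move=> h; rewrite hG //; apply: contraNneq h => ->.
apply: (@cross_chains_srep _ _ (fun x => x \in K) cl) => u v s.
  case: (eqVneq u v) => [->|uv]; first by rewrite gadj_irr.
  case: (boolP (u \in K)) => uK /=; first by rewrite cK // -s.
  by apply/negbTE/iI; rewrite IK -?s.
wlog puv : u v s / p u <= p v.
  move=> h c; case/orP: (leq_total (p u) (p v)) => le; first exact: h.
  by case: (h v u) => // hh; [right|left] => w; rewrite s; apply: hh.
move=> c.
have [->|uv] := eqVneq u v; first by left.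
have {}puv : p u < p v by rewrite ltn_neqAle puv andbT; apply/eqP/pn.
have wu w : (w \in K) != (u \in K) -> [/\ p w <> p u, p w <> p v, q w <> q u & q w <> q v].
  move=> h; have wu : w != u by apply: contraNneq h => ->.
  have wv : w != v by apply: contraNneq h => ->; rewrite s.
  by split; [apply: pn|apply: pn|apply: qn|apply: qn].
move: c; rewrite /cl -s; case: (boolP (u \in K)) => uK.
  have quv := oK _ _ uK (etrans (esym s) uK) puv.
  case: (boolP [exists i, _]) => [/existsP[i /andP[iK hi]]|/existsPn noi] /esym.
  + move=> /existsP[j /andP[jK hj]]; right=> w wK.
    have wK' : w \notin K by move: wK; case: (w \in K).
    have [|n1 n2 n3 n4] := wu w; first by rewrite uK (negPf wK').
    rewrite !adjE -?s ?uK ?(negPf wK') // => h.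
    have := oI w j wK' jK; have := oI j w jK wK'; lia.
  + move=> /negbT /existsPn noj; left=> w wK.
    have wK' : w \notin K by move: wK; case: (w \in K).
    have [|n1 n2 n3 n4] := wu w; first by rewrite uK (negPf wK').
    rewrite !adjE -?s ?uK ?(negPf wK') // => h.
    have := noi w; rewrite wK' /=; lia.
have vK : v \notin K by rewrite -s.
have quv := oI _ _ uK vK puv.
case: (boolP [exists i, _]) => [/existsP[i /andP[iK hi]]|/existsPn noi] /esym.
+ move=> /existsP[j /andP[jK hj]]; right=> w wK.
  have wK' : w \in K by move: wK; case: (w \in K).
  have [|n1 n2 n3 n4] := wu w; first by rewrite wK' (negPf uK).
  rewrite !adjE -?s ?wK' ?(negPf uK) // => h.
  have := oK w i; have := oK i w; rewrite wK' iK => /(_ isT isT) h1 /(_ isT isT) h2; lia.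
+ move=> /negbT /existsPn noj; left=> w wK.
  have wK' : w \in K by move: wK; case: (w \in K).
  have [|n1 n2 n3 n4] := wu w; first by rewrite wK' (negPf uK).
  rewrite !adjE -?s ?wK' ?(negPf uK) // => h.
  have := noj w; rewrite wK' /=; lia.
Qed.

(** Pieces are placed side by side. The offset [M.*2] is even, which keeps parities, and leaves a
    gap of at least two columns between pieces. *)
Lemma srep_zclass t G piece lay row : @srep t G piece lay row -> zclass t G.
Proof.
case=> rI rp ga _.
pose M := (\max_v lay v).+2.
have lM v : (lay v).+1 < M by rewrite !ltnS; apply: (leq_bigmax (F := lay) v).
exists (fun v => piece v * M.*2 + lay v), row; split=> // u v.
rewrite ga /zrel; congr andb; rewrite /zadj.
have par x : odd (piece x * M.*2 + lay x) = odd (lay x) by rewrite oddD oddM odd_double andbF.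
rewrite !par.
have key x y : slt piece lay row x y =
   zlt (piece x * M.*2 + lay x) (row x) (piece y * M.*2 + lay y) (row y).
  rewrite /slt /zlt; have := lM x; have := lM y.
  have [h|h|->] := ltngtP (piece x) (piece y) => /=.
  + by have := leq_mul h (leqnn M.*2); rewrite mulSn; lia.
  + by have := leq_mul h (leqnn M.*2); rewrite mulSn; lia.
  + by lia.
by rewrite !key.
Qed.

(** * Unboundedness *)

Lemma zlt_opp c r c' r' : odd c != odd c' -> r != r' ->
  zlt c' r' c r = ~~ zlt c r c' r'.
Proof. rewrite /zlt; lia. Qed.

Lemma zadj_lt t c r c' r' : odd c != odd c' -> r != r' ->
  zadj t c r c' r' = odd c (+) zlt c r c' r'.
Proof.
move=> o rr; rewrite /zadj (negPf o); case: ifP => // _.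
by rewrite zlt_opp // addTb.
Qed.

Section GridCut.
Variables (t : bool) (n k : nat).
Let N := n.+1.
Variable X : {set 'I_N * 'I_N}.
Variable kap : 'I_N * 'I_N -> 'I_k.
Hypothesis twins : forall x x' y, x \in X -> x' \in X -> y \notin X ->
  kap x = kap x' -> gadj (grid_graph t N) x y = gadj (grid_graph t N) x' y.

Definition glt (x y : 'I_N * 'I_N) := zlt x.1 (x.2 * N + (N - x.1)) y.1 (y.2 * N + (N - y.1)).

Lemma grid_twins x x' y : x \in X -> x' \in X -> y \notin X -> kap x = kap x' ->
  odd x.1 = odd x'.1 -> odd x.1 != odd y.1 -> glt x y = glt x' y.
Proof.
move=> xX x'X yX e o o'; have := twins xX x'X yX e.
have row_neq z : z \in X -> z.2 * N + (N - z.1) != y.2 * N + (N - y.1).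
  move=> zX; rewrite (inj_eq (@grid_row_inj N) z y).
  by apply: contraNneq yX => <-.
have neq z : z \in X -> z != y by move=> zX; apply: contraNneq yX => <-.
rewrite /= /zrel !neq //= !zadj_lt ?row_neq -?o // -/(glt x y) -/(glt x' y).
exact: addbI.
Qed.

Definition pt (i : nat) (j : 'I_N) : 'I_N * 'I_N := (inord i, j).

Lemma glt_pt i j i' j' : i < N -> i' < N ->
  glt (pt i j) (pt i' j') = (i.+1 < i') || (i <= i'.+1) && ((j < j') || (j == j') && (i' < i)).
Proof.
move=> hi hi'; rewrite /glt /zlt /= grid_row_lt /= !inordK //.
Qed.

Lemma pt_twins i j i' j' a b : i < N -> i' < N -> a < N ->
  pt i j \in X -> pt i' j' \in X -> pt a b \notin X -> kap (pt i j) = kap (pt i' j') ->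
  odd i = odd i' -> odd i != odd a -> glt (pt i j) (pt a b) = glt (pt i' j') (pt a b).
Proof.
by move=> hi hi' ha *; apply: grid_twins => //=; rewrite !inordK.
Qed.

Definition diffs i := [set j | (pt i j \in X) != (pt i.+1 j \in X)].

(** Consider the rows where one of two neighbouring columns is in [X] and the other is not. The
    outside vertices of these rows separate the inside ones by height, so each direction accounts
    for at most [k] rows. *)
Lemma card_diffs i : i < n -> #|diffs i| <= 2 * k.
Proof.
move=> hi; have hi1 : i < N by apply: ltnW. have hi2 : i.+1 < N by [].
have inj (a b : nat) : a < N -> b < N -> (a == b.+1) || (b == a.+1) ->
   #|[set j | (pt a j \in X) && (pt b j \notin X)]| <= k.
  move=> ha hb ab; rewrite -[X in _ <= X]card_ord.
  rewrite -(@card_in_imset _ _ (fun j => kap (pt a j))) ?max_card //.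
  move=> j j'; rewrite !inE => /andP[j1 j2] /andP[j1' j2'] e.
  have o : odd a != odd b by case/orP: ab => /eqP -> /=; case: odd.
  have := pt_twins ha ha hb j1 j1' j2 e erefl o.
  have := pt_twins ha ha hb j1 j1' j2' e erefl o.
  by rewrite !glt_pt // -!(inj_eq val_inj) /= => h1 h2; apply: val_inj => /=; lia.
have sub : diffs i \subset [set j | (pt i j \in X) && (pt i.+1 j \notin X)] :|:
                          [set j | (pt i.+1 j \in X) && (pt i j \notin X)].
  by apply/subsetP => j; rewrite !inE; case: (_ \in X); case: (_ \in X).
apply: leq_trans (subset_leq_card sub) _; apply: leq_trans (leq_card_setU _ _) _.
by rewrite mul2n -addnn leq_add // inj // eqxx ?orbT.
Qed.

Definition changes := [set i : 'I_n | diffs i != set0].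

(** Choose at each change a vertex [a] in [X] and its horizontal neighbour [b] outside. If two
    changes agree in class, in position modulo 4, in orientation and in the comparison of [a] with
    [b], they are at least four columns apart; then the earlier [a] precedes the later [b] and the
    later [a] follows the earlier [b], which is impossible for twins. This leaves [k * 4 * 2 * 2]
    values. *)
Lemma card_changes : #|changes| <= 16 * k.
Proof.
pose J (i : 'I_n) := odflt ord0 [pick j in diffs i].
have JP i : i \in changes -> (pt i (J i) \in X) != (pt i.+1 (J i) \in X).
  rewrite inE => /set0Pn[j0 hj0]; rewrite /J; case: pickP => [j|/(_ j0)] /=; first by rewrite inE.
  by rewrite hj0.
pose L (i : 'I_n) := pt i (J i) \in X.
pose a (i : 'I_n) : nat := if L i then i : nat else i.+1.
pose b (i : 'I_n) : nat := if L i then i.+1 else i : nat.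
have aN i : a i < N by rewrite /a; have := ltn_ord i; case: (L i); rewrite /N; lia.
have bN i : b i < N by rewrite /b; have := ltn_ord i; case: (L i); rewrite /N; lia.
have aX i : i \in changes -> pt (a i) (J i) \in X.
  by move/JP; rewrite /a -/(L i); case: ifP => // _; case: (_ \in X).
have bX i : i \in changes -> pt (b i) (J i) \notin X.
  by move/JP; rewrite /b -/(L i); case e: (L i) => //= ; case: (_ \in X); rewrite // -/(L i) e.
pose g i := (kap (pt (a i) (J i)), (inord (i %% 4) : 'I_4, (L i, glt (pt (a i) (J i)) (pt (b i) (J i))))).
have gI : {in changes &, injective g}.
  suff H i i' : i \in changes -> i' \in changes -> g i = g i' -> ~ i < i'.
    move=> i i' hi hi' e; apply: val_inj; case: (ltngtP i i') => // h; exfalso.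
    - exact: H hi hi' e h.
    - exact: H hi' hi (esym e) h.
  move=> hi hi' [ek em eL el] ii'.
  have {}em : i %% 4 = i' %% 4.
    by move/(congr1 val): em; rewrite /= !inordK ?ltn_pmod.
  have ea : odd (a i) = odd (a i') by rewrite /a eL; case: (L i'); move: em; clear; lia.
  have eb : odd (b i) = odd (b i') by rewrite /b eL; case: (L i'); move: em; clear; lia.
  have eab : odd (a i) != odd (b i) by rewrite /a /b; case: (L i); clear; lia.
  have h1 := pt_twins (aN i) (aN i') (bN i) (aX _ hi) (aX _ hi') (bX _ hi) ek ea eab.
  rewrite eb in eab.
  have h2 := pt_twins (aN i) (aN i') (bN i') (aX _ hi) (aX _ hi') (bX _ hi') ek ea eab.
  have f1 : glt (pt (a i) (J i)) (pt (b i') (J i')).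
    by rewrite glt_pt //; apply/orP; left; rewrite /a /b eL; case: (L i'); move: em ii'; clear; lia.
  have f2 : ~~ glt (pt (a i') (J i')) (pt (b i) (J i)).
    by rewrite glt_pt // negb_or negb_and; rewrite /a /b eL; case: (L i'); move: em ii'; clear; lia.
  by move: h1 h2; rewrite f1 (negPf f2) el => ->.
rewrite -(card_in_imset gI); apply: leq_trans (max_card _) _.
by rewrite !card_prod !card_ord card_bool mulnC.
Qed.

Definition mixed := \bigcup_(i in changes) diffs i.

Lemma card_mixed : #|mixed| <= 32 * k ^ 2.
Proof.
apply: (@leq_trans (\sum_(i in changes) #|diffs i|)).
  rewrite /mixed; elim/big_rec2: _ => [|i S m _ h]; first by rewrite cards0.
  by apply: leq_trans (leq_card_setU _ _) _; rewrite leq_add2l.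
apply: (@leq_trans (\sum_(i in changes) (2 * k))).
  by apply: leq_sum => i _; apply: card_diffs.
rewrite sum_nat_const; apply: leq_trans (leq_mul card_changes (leqnn _)) _; lia.
Qed.

Lemma unmixed_row j i : j \notin mixed -> i < N -> (pt i j \in X) = (pt 0 j \in X).
Proof.
move=> jm; elim: i => // i IH hi; rewrite -IH; last exact: ltnW.
apply/eqP; apply: contraNT jm => h; have hi' : i < n by [].
have jd : j \in diffs i by rewrite inE eq_sym.
apply/bigcupP; exists (Ordinal hi') => //; rewrite inE; apply/set0Pn.
by exists j.
Qed.

Lemma mixed_rows_card (Y : {set 'I_N * 'I_N}) :
  (forall x, x \in Y -> x.2 \in mixed) -> #|Y| <= N * (32 * k ^ 2).
Proof.
move=> h; apply: leq_trans (_ : #|setX [set: 'I_N] mixed| <= _).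
  by apply/subset_leq_card/subsetP => -[i j] /h; rewrite !inE.
by rewrite cardsX cardsT card_ord leq_mul // card_mixed.
Qed.

(** Mixed rows hold at most [32 * k ^ 2 * N] vertices, fewer than [X] or its complement, so some row
    [j] lies inside [X] and some row [j'] outside. The vertices of row [j] in columns [4 * i] are
    separated by those of row [j'] in columns [4 * i + 1], giving [k.+1] classes. *)
Lemma grid_cut_bound : #|X| <= (N * N)./2 -> (N * N)./2 < 2 * #|X| -> N < 128 * k ^ 2 + 4 * k + 4.
Proof.
move=> hX1 hX2; rewrite ltnNge; apply/negP => hN.
have ptE (x : 'I_N * 'I_N) : x = pt x.1 x.2.
  by case: x => i j; rewrite /pt /=; congr pair; rewrite inord_val.
have nn : N * (128 * k ^ 2 + 4) <= N * N by rewrite leq_mul2l; lia.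
have [j jm jX] : exists2 j, j \notin mixed & pt 0 j \in X.
  case: (pickP (fun j => (j \notin mixed) && (pt 0 j \in X))) => [j /andP[]|no]; first by exists j.
  have /mixed_rows_card : forall x, x \in X -> x.2 \in mixed.
    move=> x xX; apply/negPn/negP => xm; have := no x.2; rewrite xm /=.
    by rewrite -(unmixed_row xm (ltn_ord x.1)) -ptE xX.
  by move: nn hX2; clear; rewrite /N; nia.
have [j' jm' jX'] : exists2 j, j \notin mixed & pt 0 j \notin X.
  case: (pickP (fun j => (j \notin mixed) && (pt 0 j \notin X))) => [j' /andP[]|no]; first by exists j'.
  have : forall x, x \in ~: X -> x.2 \in mixed.
    move=> x; rewrite inE => xX; apply/negPn/negP => xm; have := no x.2; rewrite xm /=.
    by rewrite -(unmixed_row xm (ltn_ord x.1)) -ptE xX.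
  move/mixed_rows_card; have := cardsC X; rewrite card_prod !card_ord.
  by move: nn hX1; clear; rewrite /N; nia.
have iN (i : 'I_k.+1) : 4 * i < N /\ (4 * i).+1 < N.
  by have := ltn_ord i; move: hN; rewrite /N; lia.
have inj : injective (fun i : 'I_k.+1 => kap (pt (4 * i) j)).
  suff H (i i' : 'I_k.+1) : kap (pt (4 * i) j) = kap (pt (4 * i') j) -> ~ i < i'.
    move=> i i' e; apply: val_inj; case: (ltngtP i i') => // h; exfalso.
    - exact: H e h.
    - exact: H (esym e) h.
  move=> e ii'; have [i1 i2] := iN i; have [i1' i2'] := iN i'.
  have X1 : pt (4 * i) j \in X by rewrite unmixed_row.
  have X2 : pt (4 * i') j \in X by rewrite unmixed_row.
  have Y1 : pt (4 * i).+1 j' \notin X by rewrite unmixed_row.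
  have Y2 : pt (4 * i').+1 j' \notin X by rewrite unmixed_row.
  have o : odd (4 * i) = odd (4 * i') by clear; lia.
  have o1 : odd (4 * i) != odd (4 * i).+1 by clear; lia.
  have o2 : odd (4 * i) != odd (4 * i').+1 by clear; lia.
  have := pt_twins i1 i1' i2 X1 X2 Y1 e o o1.
  have := pt_twins i1 i1' i2' X1 X2 Y2 e o o2.
  rewrite !glt_pt //; move: ii'; clear; lia.
by have := leq_card _ inj; rewrite !card_ord ltnn.
Qed.

End GridCut.

Lemma grid_unbounded_cw t k : exists n, ~ cw_le k (grid_graph t n).
Proof.
exists (128 * k ^ 2 + 4 * k + 4) => h.
set N := _ + 4 in h *; have [n eN] : exists n, N = n.+1 by exists N.-1; rewrite /N; lia.
move: (erefl N); rewrite {2}/N; rewrite eN in h *.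
have n4 : 4 <= n.+1 by rewrite -eN /N; lia.
case: (@cw_balanced_cut _ _ (n.+1 * n.+1)./2 h) => [|X [h1 h2 [kap tw]]].
  by rewrite /= card_prod !card_ord; nia.
by have := grid_cut_bound tw h1 h2; move=> h3 h4; rewrite -h4 ltnn in h3.
Qed.

(** * Graphs without a large grid *)

Lemma cut_le_fin (T V : finType) (e : rel V) (X : {set V}) (kap : V -> T) :
  (forall x x' y, x \in X -> x' \in X -> y \notin X -> kap x = kap x' -> e x y = e x' y) ->
  cut_le #|T| e X.
Proof. by move=> h; exists (fun v => enum_rank (kap v)) => x x' y ? ? ? /enum_rank_inj; apply: h. Qed.

Lemma zlt_shift c i r i' r' : zlt (c + i) r (c + i') r' = zlt i r i' r'.
Proof. by rewrite /zlt; lia. Qed.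

Lemma zadj_shift t c i r i' r' : ~~ odd c -> zadj t (c + i) r (c + i') r' = zadj t i r i' r'.
Proof. by move=> /negPf oc; rewrite /zadj !zlt_shift !oddD oc. Qed.

Section GridFree.
Variables (t : bool) (G : graph) (col row : gV G -> nat) (n : nat).
Hypothesis rep : zrep t col row.
Hypothesis n_gt0 : 0 < n.
Hypothesis free : ~ induced_sub (grid_graph t n) G.
Let V := gV G.

Let rI : injective row. Proof. by case: rep. Qed.
Let rp v : 0 < row v. Proof. by case: rep. Qed.

Definition prev i r := \max_(x : V | (col x == i) && (row x < r)) row x.

Lemma prev_ge i r x : col x = i -> row x < r -> row x <= prev i r.
Proof. by move=> cx rx; apply: leq_bigmax_cond; rewrite cx eqxx. Qed.

Lemma prev_le i r : prev i r <= r.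
Proof. by apply/bigmax_leqP => x /andP[_ /ltnW]. Qed.

Lemma prev_mono i r s : r <= s -> prev i r <= prev i s.
Proof.
move=> rs; apply/bigmax_leqP => x /andP[/eqP cx rx]; apply: prev_ge => //.
exact: leq_trans rx rs.
Qed.

Lemma prev_attained i r : 0 < prev i r -> exists x, col x = i /\ row x = prev i r.
Proof.
move=> h; case: (pickP (fun x : V => (col x == i) && (row x < r))) => [x0 Px0|no].
  have := @eq_bigmax_cond _ (fun x : V => (col x == i) && (row x < r)) row.
  case=> [|x]; first by apply/card_gt0P; exists x0.
  by move=> /andP[/eqP cx _] e; exists x; rewrite cx /prev e.
by move: h; rewrite /prev big_pred0.
Qed.

(** The trajectory from height [r]: in each of the columns [c], [c + 1], ... it drops to the highest
    vertex strictly below, or to 0 if there is none. *)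
Fixpoint tau c i r := if i is i'.+1 then prev (c + i') (tau c i' r) else r.

Lemma tau_mono c i r s : r <= s -> tau c i r <= tau c i s.
Proof. by elim: i => //= i IH /IH; apply: prev_mono. Qed.

Lemma tau_anti c i j r : i <= j -> tau c j r <= tau c i r.
Proof.
move/subnK <-; elim: (j - i) => // m IH; rewrite addSn /=.
exact: leq_trans (prev_le _ _) IH.
Qed.

Lemma tau_inj c i j r s : i <= j -> tau c i r = tau c i s -> tau c j r = tau c j s.
Proof. by move/subnK <- => e; elim: (j - i) => // m IH; rewrite addSn /= IH. Qed.

(** This numbers the groups of starting heights whose trajectories agree after [n] columns; by
    monotonicity these groups are intervals. *)
Definition jumps c r := count (fun s => tau c n s < tau c n s.+1) (iota 0 r).

Lemma jumpsS c r : jumps c r.+1 = jumps c r + (tau c n r < tau c n r.+1).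
Proof. by rewrite /jumps -[in LHS]addn1 iotaD count_cat /= addn0. Qed.

Lemma jumps_tau c r s : jumps c r = jumps c s -> tau c n r = tau c n s.
Proof.
wlog rs : r s / r <= s => [h e|].
  by case/orP: (leq_total r s) => le; [apply: h|apply/esym/h].
rewrite -(subnK rs); elim: (s - r) => // m IH; rewrite addSn jumpsS => e.
have le k : jumps c r <= jumps c (k + r).
  by elim: k => // k IHk; rewrite addSn jumpsS; apply: leq_trans IHk (leq_addr _ _).
have e1 : jumps c r = jumps c (m + r) by have := le m; move: e; clear; lia.
rewrite (IH e1); apply/eqP; rewrite eqn_leq tau_mono //=.
by rewrite leqNgt; apply/negP => h; move: e; rewrite h e1; clear; lia.
Qed.

(** Starting just above each of [n] jumps gives [n] trajectories with distinct positive ends, hence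
    distinct throughout, and their vertices form the grid. Evenness of [c] preserves the sides. *)
Lemma jumps_lt c r : ~~ odd c -> jumps c r < n.
Proof.
move=> oc; rewrite ltnNge; apply/negP => big; apply: free.
set P := fun s => tau c n s < tau c n s.+1.
pose s := filter P (iota 0 r).
have ss : n <= size s by rewrite size_filter.
pose T j := (nth 0 s j).+1.
have TP j : j < n -> P (T j).-1.
  move=> hj; have : nth 0 s j \in s by apply: mem_nth; apply: leq_trans ss.
  by rewrite mem_filter => /andP[].
have Tlt j j' : j < j' -> j' < n -> T j <= (T j').-1.
  move=> jj hj; have so : sorted ltn s by apply: sorted_filter (iota_ltn_sorted _ _); exact: ltn_trans.
  apply: (sorted_ltn_nth ltn_trans 0 so) => //; rewrite inE; apply: leq_trans ss => //.
  exact: ltn_trans hj.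
have glt_ j j' : j < j' -> j' < n -> tau c n (T j) < tau c n (T j').
  by move=> jj hj; apply: leq_ltn_trans (TP _ hj); apply: tau_mono; apply: Tlt.
have tlt i j j' : i <= n -> j < j' -> j' < n -> tau c i (T j) < tau c i (T j').
  move=> hi jj hj; rewrite ltn_neqAle tau_mono ?andbT; last first.
    by apply: leq_trans (Tlt _ _ jj hj) _; apply: leq_pred.
  apply/eqP => /(tau_inj hi) e; have := glt_ _ _ jj hj; by rewrite e ltnn.
have tpos i j : i <= n -> j < n -> 0 < tau c i (T j).
  move=> hi hj; apply: leq_trans (tau_anti _ _ hi).
  by apply: leq_ltn_trans (TP _ hj).
have ex (x : 'I_n * 'I_n) : {v | (col v == c + x.1) && (row v == tau c x.1.+1 (T x.2))}.
  apply: sigW; have [v [cv rv]] := prev_attained (tpos x.1.+1 x.2 (ltn_ord _) (ltn_ord _)).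
  by exists v; rewrite cv rv !eqxx.
pose e x := sval (ex x).
have ec x : col (e x) = c + x.1 by have /andP[/eqP] := svalP (ex x).
have er x : row (e x) = tau c x.1.+1 (T x.2) by have /andP[_ /eqP] := svalP (ex x).
have eI : injective e.
  move=> [i j] [i' j'] E; have := ec (i, j); rewrite E ec /= => /addnI /val_inj ei.
  have er' : tau c i'.+1 (T j) = tau c i'.+1 (T j') by rewrite -[LHS](er (i', j)) ei E er /= ei.
  congr pair; first exact: esym.
  apply: val_inj; case: (ltngtP j j') => // h.
  - by have := tlt i'.+1 _ _ (ltn_ord _) h (ltn_ord _); rewrite er' ltnn.
  - by have := tlt i'.+1 _ _ (ltn_ord _) h (ltn_ord _); rewrite er' ltnn.
(* A trajectory takes the highest vertex available. If the vertex of a higher trajectory in the next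
   column were below the lower trajectory, that one would have taken it or something higher. *)
have next (i i' j j' : 'I_n) : i' = i.+1 :> nat ->
    (row (e (i, j)) < row (e (i', j'))) = (j < j').
  move=> ii'; have er' := er (i', j'); have er0 := er (i, j); have ec' := ec (i', j').
  case: (ltnP j j') => jj.
    rewrite ltnNge leq_eqVlt (inj_eq rI) (inj_eq eI) xpair_eqE -(inj_eq val_inj) /= ii'.
    rewrite (gtn_eqF (ltnSn i)) /=; apply/negP => E.
    have := prev_ge ec' E; rewrite er0 er' /= ii' leqNgt.
    by have := tlt i.+2 _ _ _ jj (ltn_ord _); rewrite -{1}ii' => /(_ (ltn_ord _)) /= ->.
  apply/negbTE; rewrite -leqNgt er0 er' /=; apply: leq_trans (prev_le _ _) _.
  rewrite ii' /=; apply: (@tau_mono c i.+1).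
  case: (ltngtP j' j) jj => // [h _|->//].
  by apply: leq_trans (Tlt _ _ h (ltn_ord _)) _; apply: leq_pred.
apply: (zgraph_sub rep eI) => -[i j] [i' j'] xy.
rewrite !ec zadj_shift //=.
have key (a a' b b' : 'I_n) : odd a != odd a' ->
   zlt a (b * n + (n - a)) a' (b' * n + (n - a')) = zlt a (row (e (a, b))) a' (row (e (a', b'))).
  move=> o; rewrite /zlt grid_row_lt -(inj_eq val_inj) /=.
  case: (ltnP a.+1 a') => //= h1; case: (leqP a a'.+1) => //= h2.
  have [h|h] : a' = a.+1 :> nat \/ a = a'.+1 :> nat by move: o h1 h2; clear; lia.
    have -> : (a' < a) = false by rewrite h; clear; lia.
    by rewrite next // andbF orbF.
  have -> : a' < a by rewrite h.
  have -> : (row (e (a, b)) < row (e (a', b'))) = ~~ (b' < b).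
    rewrite -(next _ _ _ _ h) -leqNgt [RHS]leq_eqVlt (inj_eq rI) (inj_eq eI) xpair_eqE.
    suff -> : (a == a') = false by [].
    by apply/eqP => E; move: h; rewrite E; clear; lia.
  by rewrite andbT orbC -leq_eqVlt leqNgt.
by rewrite /zadj; case: ifP => // /negbT o; case: ifP => _; rewrite key // eq_sym.
Qed.

Definition height := (\max_v row v).+1.
Lemma row_lt_height v : row v < height. Proof. by rewrite ltnS; apply: (leq_bigmax (F := row) v). Qed.

(* [v] lies between two trajectories that have merged by column [c + n]. *)
Definition between c v (r s : nat) :=
  (tau c n r == tau c n s) && (tau c (col v - c) r <= row v < tau c (col v - c) s).

Definition region c := [set v : V | (col v <= c) ||
  (col v < c + n) && [exists r : 'I_height.+1, [exists s : 'I_height.+1, between c v r s]]].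

Lemma regionI c v r s : r <= height -> s <= height -> col v < c + n -> between c v r s -> v \in region c.
Proof.
move=> hr hs cv b; rewrite inE cv; apply/orP; right.
by apply/existsP; exists (inord r); apply/existsP; exists (inord s); rewrite !inordK.
Qed.

Lemma region_gt c v : v \notin region c -> c < col v.
Proof. by rewrite inE negb_or -ltnNge => /andP[]. Qed.

Lemma region_lt c v : v \in region c -> col v < c + n.
Proof. by rewrite inE => /orP[h|/andP[]//]; move: h n_gt0; clear; lia. Qed.

Lemma region_sub c d : c + n <= d -> region c \subset region d.
Proof. by move=> cd; apply/subsetP => v /region_lt h; rewrite inE ltnW //; apply: leq_trans h cd. Qed.

(** A vertex of a neighbouring column whose height lies between two vertices of an enclosed strip is
    caught in the strip: to the right, because trajectories take the highest vertex below; to the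
    left, because the lower one would otherwise have stopped at it. At column [c + n] the strip has
    closed. *)
Lemma between_outside c i x x' y r s : r <= height -> s <= height -> i < n ->
  col x = c + i -> col x' = c + i -> tau c n r = tau c n s ->
  tau c i r <= row x -> row x' < tau c i s -> y \notin region c ->
  col y = (col x).+1 \/ col x = (col y).+1 -> row x < row y -> row y < row x' -> False.
Proof.
move=> hr hs hi cx cx' e lx ux hy cy xy yx'.
have cyc := region_gt hy.
case: cy => cy.
- have h1 : tau c i.+1 r <= row y.
    by apply: leq_trans (prev_le _ _) _; apply: leq_trans lx (ltnW xy).
  have h2 : row y < tau c i.+1 s by apply: leq_trans yx' (prev_ge cx' ux).
  have [hin|hin] := ltnP i.+1 n; last first.
    have ein : n = i.+1 by apply/eqP; rewrite eqn_leq hin hi.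
    by move: h1; rewrite -ein e ein leqNgt h2.
  move/negP: hy; apply; apply: (@regionI _ _ r s) => //.
    by rewrite cy cx -addnS ltn_add2l.
  by rewrite /between e eqxx cy cx -addnS addKn h1 h2.
- case: i hi cx cx' lx ux => [|i] hi cx cx' lx ux; first by move: cyc cx cy; clear; lia.
  have cy' : col y = c + i by move: cy cx; clear; lia.
  have h2 : row y < tau c i s.
    by apply: leq_trans yx' _; apply: leq_trans (ltnW ux) (prev_le _ _).
  have h1 : tau c i r <= row y.
    rewrite leqNgt; apply/negP => /(prev_ge cy').
    rewrite leqNgt => /negP; apply; exact: leq_ltn_trans lx xy.
  move/negP: hy; apply; apply: (@regionI _ _ r s) => //.
    by rewrite cy' ltn_add2l ltnW.
  by rewrite /between e eqxx cy' addKn h1 h2.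
Qed.

(* Column [c] lies entirely in the region, including the vertices at which the
   trajectories do not merge: these get pairs of distinct entries. *)
Definition interval c v : 'I_n.+1 * 'I_n.+1 :=
  if col v == c then (inord (jumps c (row v)), inord (jumps c (row v).+1))
  else if [pick p : 'I_height.+1 * 'I_height.+1 | between c v p.1 p.2] is Some p
  then (inord (jumps c p.1), inord (jumps c p.2)) else (ord0, ord0).

Definition cut_class := (bool * option ('I_n.+1 * ('I_n.+1 * 'I_n.+1)))%type.

Definition region_class c v : cut_class :=
  (odd (col v), if col v < c then None else Some (inord (col v - c), interval c v)).

Lemma interval_spec c x x' : ~~ odd c -> x \in region c -> x' \in region c ->
  c <= col x -> col x = col x' -> row x < row x' -> interval c x = interval c x' ->
  exists r s, [/\ r <= height, s <= height, tau c n r = tau c n s,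
     tau c (col x - c) r <= row x & row x' < tau c (col x - c) s].
Proof.
move=> oc xX xX' cx cxx' xx'; rewrite /interval -cxx'.
have inj r s : inord (jumps c r) = inord (jumps c s) :> 'I_n.+1 -> tau c n r = tau c n s.
  move/(congr1 val); rewrite /= !inordK; first exact: jumps_tau.
  - by apply: ltnW; apply: jumps_lt.
  - by apply: ltnW; apply: jumps_lt.
case: (eqVneq (col x) c) => [ex|nx].
  case=> /inj e1 /inj e2; exists (row x), (row x').+1; split.
  - by apply: ltnW; apply: row_lt_height.
  - exact: row_lt_height.
  - apply/eqP; rewrite eqn_leq tau_mono /=; last by apply: ltnW; apply: ltnW.
    by rewrite -e2 e1; apply: tau_mono.
  - by rewrite ex subnn.
  - by rewrite ex subnn.
have pickr y : y \in region c -> col y = col x ->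
   exists2 p : 'I_height.+1 * 'I_height.+1, between c y p.1 p.2 &
     [pick p : 'I_height.+1 * 'I_height.+1 | between c y p.1 p.2] = Some p.
  move=> yX ey; case: pickP => [p hp|no]; first by exists p.
  move: yX; rewrite inE leqNgt ey ltn_neqAle eq_sym nx cx /= => /andP[_ /existsP[r /existsP[s b]]].
  by have := no (r, s); rewrite /= b.
have [p bp ->] := pickr x xX erefl; have [p' bp' ->] := pickr x' xX' (esym cxx').
case=> /inj e1 /inj e2; exists p.1, p'.2.
have rs (i : 'I_height.+1) : i <= height by rewrite -ltnS.
move: bp bp' => /andP[/eqP e3 /andP[h1 h2]] /andP[/eqP e4 /andP[h3 h4]].
by split=> //; [rewrite e3 e2|rewrite cxx'].
Qed.

Lemma gadj_eq x x' y : odd (col x) = odd (col x') -> x != y -> x' != y ->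
  (odd (col x) != odd (col y) -> zlt (col x) (row x) (col y) (row y) = zlt (col x') (row x') (col y) (row y)) ->
  gadj G x y = gadj G x' y.
Proof.
case: rep => _ _ ga e xy xy' h; rewrite !ga /zrel xy xy' /=.
case: (eqVneq (odd (col x)) (odd (col y))) => [o|o]; first by rewrite /zadj -e o eqxx.
by rewrite !zadj_lt -?e ?(inj_eq rI) // h.
Qed.

(** Vertices in columns before [c] precede all outside vertices of the other side. Equal classes
    from column [c] on mean the same column and a common strip, so only a vertex caught in the strip
    could separate them. *)
Lemma region_twins c x x' y : ~~ odd c -> x \in region c -> x' \in region c -> y \notin region c ->
  region_class c x = region_class c x' -> gadj G x y = gadj G x' y.
Proof.
move=> oc.
wlog xx' : x x' / row x <= row x' => [h xX x'X yX e|].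
  case/orP: (leq_total (row x) (row x')) => le; first exact: h.
  by apply/esym; apply: h.
move=> xX x'X yX [e1 e2].
have neq z : z \in region c -> z != y by move=> zX; apply: contraNneq yX => <-.
have [->//|nxx'] := eqVneq x x'.
have {}xx' : row x < row x' by rewrite ltn_neqAle (inj_eq rI) nxx'.
apply: gadj_eq; rewrite ?neq // => o.
have cy := region_gt yX.
move: e2; case: ltnP => cx; case: ltnP => cx' //.
  by move=> _; have := e1; rewrite /zlt; move: o cx cx' cy; clear; lia.
case=> /(congr1 val); rewrite /= !inordK; last first.
- by have := region_lt xX; move: cx; clear; lia.
- by have := region_lt x'X; move: cx'; clear; lia.
move=> ec ei; have cxx' : col x = col x' by move: ec cx cx'; clear; lia.
have [r [s [hr hs e lx ux]]] := interval_spec oc xX x'X cx cxx' xx' ei.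
have hi : col x - c < n by have := region_lt xX; move: cx; clear; lia.
rewrite /zlt -cxx'; case: (ltnP (col x).+1 (col y)) => //= c1.
case: (leqP (col x) (col y).+1) => //= c2.
have adj : col y = (col x).+1 \/ col x = (col y).+1 by move: o c1 c2; clear; lia.
have ryx' : row y != row x' by rewrite (inj_eq rI) eq_sym neq.
apply/idP/idP => [xy|]; last exact: ltn_trans.
rewrite ltnNge; apply/negP => yx'.
apply: (@between_outside c (col x - c) x x' y r s) => //.
- by rewrite subnKC.
- by rewrite subnKC -?cxx'.
- by rewrite ltn_neqAle ryx'.
Qed.

(** Even, as [jumps_lt] requires, and with steps of at least [n], so that the regions are nested. *)
Definition base j := (j * n).*2.

Lemma base_even j : ~~ odd (base j). Proof. by rewrite odd_double. Qed.

Lemma region_base_sub i j : i <= j -> region (base i) \subset region (base j).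
Proof.
rewrite leq_eqVlt => /orP[/eqP ->//|ij]; apply: region_sub.
have := leq_mul ij (leqnn n); rewrite /base mulSn; clear; lia.
Qed.

Lemma in_region_base v : exists j, v \in region (base j).
Proof.
exists (col v); rewrite inE; apply/orP; left; rewrite /base.
by have := leq_mul (leqnn (col v)) n_gt0; clear; lia.
Qed.

Definition block v := ex_minn (in_region_base v).

Lemma block_le v j : (block v <= j) = (v \in region (base j)).
Proof.
rewrite /block; case: ex_minnP => m mX hm; apply/idP/idP; last exact: hm.
by move=> /region_base_sub/subsetP; apply.
Qed.

Definition key v := block v * height + row v.

Lemma key_lt v m : (key v < m) = (block v < m %/ height) || (block v == m %/ height) && (row v < m %% height).
Proof.
by rewrite /key {1}(divn_eq m height) block_lt ?row_lt_height // ltn_mod.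
Qed.

Lemma key_inj : injective key.
Proof.
move=> u v e; apply: rI; have := congr1 (fun m => m %% height) e.
by rewrite /key !modnMDl !modn_small ?row_lt_height.
Qed.

Definition prefix_class := (option 'I_(4 * n).+1 * cut_class)%type.

(** A prefix is a region plus the lower part of the next block. Against later blocks [region_twins]
    applies to either part. Against the rest of the same block, all of it at least as high as the
    cut, two vertices of the lower part in the same column compare equally. *)
Lemma prefix_cut m : cut_le #|{: prefix_class}| (gadj G) [set v | key v < m].
Proof.
pose q := m %/ height; pose s := m %% height.
pose kap v : prefix_class := if block v < q then (None, region_class (base q.-1) v)
  else (Some (inord (col v - (base q - n.*2))), region_class (base q) v).
apply: (@cut_le_fin _ _ _ _ kap) => x x' y; rewrite !inE !key_lt -/q -/s => hx hx' hy.
have neq z : (block z < q) || (block z == q) && (row z < s) -> z != y.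
  by move=> hz; apply: contraNneq hy => <-.
have [xy x'y] := (neq _ hx, neq _ hx').
have inq z : block z < q -> z \in region (base q.-1).
  by rewrite -block_le; clear; lia.
rewrite /kap; case: ifP hx => bx /= hx; case: ifP hx' => bx' /= hx' //.
  case=> h1 h2; apply: (@region_twins (base q.-1)).
  - exact: base_even.
  - exact: inq.
  - exact: inq.
  - by rewrite -block_le -ltnNge; move: hy bx; clear; lia.
  - by rewrite /region_class h1 h2.
move=> [ec e1 e2].
move: hx hx' => /andP[/eqP qx sx] /andP[/eqP qx' sx'].
have [qy|qy] := ltnP q (block y).
  apply: (@region_twins (base q)); rewrite ?base_even -?block_le ?qx ?qx' -?ltnNge //.
  by rewrite /region_class e1 e2.
have ey : block y = q by move: qy hy; clear; lia.
(* A block lies between the start of the previous region and the end of its own, a window of bounded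
   width; for [q = 0] the truncated subtraction gives 0. *)
have colb z : block z = q -> base q - n.*2 <= col z /\ col z - (base q - n.*2) < (4 * n).+1.
  move=> bz; split; last first.
    have : z \in region (base q) by rewrite -block_le bz.
    by move/region_lt; clear; lia.
  case eq : q => [|q']; first by rewrite /base mul0n sub0n.
  have : z \notin region (base q') by rewrite -block_le bz eq ltnn.
  by move/region_gt; rewrite /base mulSn; clear; lia.
have [b1 b2] := colb x qx; have [b1' b2'] := colb x' qx'.
have cxx' : col x = col x'.
  by move: ec => /(congr1 val); rewrite /= !inordK //; move: b1 b1'; clear; lia.
apply: gadj_eq => // o; rewrite /zlt -cxx'.
move: hy; rewrite ey ltnn eqxx /= -leqNgt => hy.
by rewrite (leq_trans sx hy) (leq_trans sx' hy).
Qed.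

Lemma grid_free_cw : cw_le (#|{: prefix_class}|.+1 + #|{: prefix_class}|) G.
Proof. exact: linear_cw key_inj prefix_cut. Qed.

End GridFree.

(** * Higman's lemma *)

Section Higman.
Variables (W : Type) (le : W -> W -> Prop).

Lemma dependent_choice (T : Type) (Q : T -> Prop) (nxt : nat -> T -> T -> Prop) x0 : Q x0 ->
  (forall n x, Q x -> exists y, Q y /\ nxt n x y) ->
  exists f : nat -> T, f 0 = x0 /\ forall n, Q (f n) /\ nxt n (f n) (f n.+1).
Proof.
move=> q0 step.
have step' n (x : {x | Q x}) : {y : {y | Q y} | nxt n (sval x) (sval y)}.
  apply: constructive_indefinite_description.
  by have [y [qy xy]] := step n _ (svalP x); exists (exist _ y qy).
pose f := fix f n : {x | Q x} := if n is m.+1 then sval (step' m (f m)) else exist _ x0 q0.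
exists (fun n => sval (f n)); split=> // n; split; first exact: svalP.
exact: (svalP (step' n (f n))).
Qed.

Lemma increasing_lt (f : nat -> nat) : (forall n, f n < f n.+1) -> forall i j, i < j -> f i < f j.
Proof.
move=> h i; elim=> // j IH; rewrite ltnS leq_eqVlt => /orP[/eqP -> //|/IH l].
exact: ltn_trans l (h j).
Qed.

(** Terms with no larger later term cannot occur arbitrarily late, since they would form a sequence
    without an increasing pair. Beyond the last of them a subsequence is chosen greedily. *)
Lemma monotone_subsequence (s : nat -> W) : wqo le -> exists f : nat -> nat,
  (forall i j, i < j -> f i < f j) /\ forall i j, i < j -> le (s (f i)) (s (f j)).
Proof.
move=> [[refl trans] hgood].
have [N hN] : exists N, forall n, N <= n -> exists m, n < m /\ le (s n) (s m).
  apply: NNPP => no.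
  have term N : exists n, N <= n /\ forall m, n < m -> ~ le (s n) (s m).
    apply: NNPP => h; apply: no; exists N => n Nn; apply: NNPP => h'; apply: h; exists n; split=> // m nm l.
    by apply: h'; exists m.
  have [n0 [_ t0]] := term 0.
  have [f [_ hf]] := @dependent_choice nat (fun n => forall m, n < m -> ~ le (s n) (s m))
     (fun _ n m => n < m) n0 t0 (fun _ n _ => let: ex_intro m (conj a b) := term n.+1 in
        ex_intro _ m (conj b a)).
  have [i [j [ij l]]] := hgood (s \o f).
  have [ti _] := hf i; apply: (ti (f j)) l; apply: increasing_lt ij => n.
  by have [_] := hf n.
have [f [f0 hf]] := @dependent_choice nat (fun n => N <= n)
  (fun _ n m => n < m /\ le (s n) (s m)) N (leqnn N) (fun _ n Nn => let: ex_intro m (conj a b) := hN n Nn in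
    ex_intro _ m (conj (leq_trans Nn (ltnW a)) (conj a b))).
exists f; split; first by apply: increasing_lt => n; have [_ []] := hf n.
move=> i j; elim: j => // j IH; rewrite ltnS leq_eqVlt => /orP[/eqP ->|/IH l].
  by have [_ []] := hf j.
by apply: trans l _; have [_ []] := hf j.
Qed.

Inductive embeds : seq W -> seq W -> Prop :=
| embeds_nil t : embeds [::] t
| embeds_skip y s t : embeds s t -> embeds s (y :: t)
| embeds_cons x y s t : le x y -> embeds s t -> embeds (x :: s) (y :: t).

Lemma embeds_index s t : embeds s t -> exists f : nat -> nat,
  (forall i j, i < j -> j < size s -> f i < f j) /\
  forall i, i < size s -> f i < size t /\ forall x y, le (nth x s i) (nth y t (f i)).
Proof.
elim=> {s t} [t|y s t _ [f [f1 f2]]|x y s t xy _ [f [f1 f2]]].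
- by exists id.
- exists (fun i => (f i).+1); split=> [i j ij js|i /f2 [h1 h2]]; last by split.
  by rewrite ltnS; apply: f1.
- exists (fun i => if i is i'.+1 then (f i').+1 else 0); split.
  + by move=> [|i] [|j] //= ij js; rewrite ltnS; apply: f1.
  + by case=> [|i] //= /f2 [h1 h2]; split.
Qed.

Lemma embeds_refl : (forall x, le x x) -> forall s, embeds s s.
Proof. by move=> r; elim=> [|x s IH]; [apply: embeds_nil|apply: embeds_cons]. Qed.

Lemma embeds_trans : (forall x y z, le x y -> le y z -> le x z) ->
  forall s t u, embeds s t -> embeds t u -> embeds s u.
Proof.
move=> tr s t u st tu; elim: tu s st => {t u} [u s st|y t u _ IH s /IH|x y t u xy tu IH s st].
- by inversion st; apply: embeds_nil.
- exact: embeds_skip.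
- inversion st; subst.
  + exact: embeds_nil.
  + by apply: embeds_skip; apply: IH.
  + by apply: embeds_cons; [apply: tr xy|apply: IH].
Qed.

Definition bad_seq (s : nat -> seq W) := forall i j, i < j -> ~ embeds (s i) (s j).

Lemma minimal_bad_step (n : nat) (s : nat -> seq W) : bad_seq s ->
  exists s', bad_seq s' /\ ((forall i, i < n -> s' i = s i) /\
    forall s'', bad_seq s'' -> (forall i, i < n -> s'' i = s' i) -> size (s' n) <= size (s'' n)).
Proof.
move=> bs; have [m] := ubnP (size (s n)); elim: m s bs => // m IH s bs; rewrite ltnS => hm.
case: (classic (exists s'', [/\ bad_seq s'', forall i, i < n -> s'' i = s i & size (s'' n) < size (s n)])).
  case=> s'' [b'' e'' lt'']; have [|s' [b' [e' m']]] := IH s'' b''; first exact: leq_trans lt'' hm.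
  by exists s'; split=> //; split=> // i hi; rewrite e' // e''.
move=> no; exists s; split=> //; split=> // s'' b'' e''; rewrite leqNgt; apply/negP => lt''.
by apply: no; exists s''.
Qed.

(* The minimal bad sequence argument of Nash-Williams. *)
Theorem higman : wqo le -> wqo embeds.
Proof.
move=> hw; have [[refl trans] _] := hw; split.
  by split; [apply: embeds_refl|apply: embeds_trans].
move=> s0; apply: NNPP => no.
have bs0 : bad_seq s0 by move=> i j ij l; apply: no; exists i, j.
have [F [F0 hF]] := dependent_choice bs0 minimal_bad_step.
(* Stage [m] no longer changes terms below [m], so the diagonal is the limit of the stages. *)
pose f n := F n.+1 n.
have Fst n k : F (n.+1 + k) n = f n.
  elim: k => [|k IH]; first by rewrite addn0.
  have [_ [e _]] := hF (n.+1 + k); rewrite addnS e //; lia.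
have FE m n : n < m -> F m n = f n.
  by move=> nm; rewrite -(subnKC nm) Fst.
have bf : bad_seq f.
  move=> i j ij; have [b _] := hF j.+1; have := b i j ij; by rewrite !FE // ltnW.
have fmin n s : bad_seq s -> (forall i, i < n -> s i = f i) -> size (f n) <= size (s n).
  move=> bs es; have [_ [_ m]] := hF n; apply: m => // i hi.
  by rewrite es // FE // ltnW.
have w0 : W.
  case e: (f 0) => [|w l]; last exact: w.
  by case: (bf 0 1); rewrite // e; apply: embeds_nil.
have fcons n : f n = head w0 (f n) :: behead (f n).
  case e: (f n) => //; case: (bf n n.+1) => //; rewrite e; exact: embeds_nil.
have [g [gi gl]] := monotone_subsequence (fun n => head w0 (f n)) hw.
(* From index [g 0] on, words are replaced by the tails of those whose heads increase. The result is
   still bad but has a shorter word at [g 0], contradicting minimality. *)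
pose s n := if n < g 0 then f n else behead (f (g (n - g 0))).
have bs : bad_seq s.
  move=> i j ij; rewrite /s; case: ltnP => hi; case: ltnP => hj.
  - exact: bf.
  - move=> l; apply: (bf i (g (j - g 0))).
      apply: leq_trans hi _; case: (j - g 0) => // k; apply: ltnW; exact: gi.
    by rewrite (fcons (g _)); apply: embeds_skip.
  - by move: ij hi hj; clear; lia.
  - have gij : i - g 0 < j - g 0 by move: ij hi hj; clear; lia.
    move=> l; apply: (bf _ _ (gi _ _ gij)).
    rewrite (fcons (g (i - g 0))) (fcons (g (j - g 0))); apply: embeds_cons => //.
    exact: gl.
have := fmin (g 0) s bs; rewrite /s ltnn subnn fcons /= ltnn => h.
suff : false by []. by apply: h => i ->.
Qed.

End Higman.

(** Pass to a subsequence increasing in [W] and apply the pigeonhole principle to its first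
    [#|T|.+1] terms. *)
Lemma wqo_fin_prod (T : finType) (W : Type) (le : W -> W -> Prop) : wqo le ->
  wqo (fun x y : T * W => x.1 = y.1 /\ le x.2 y.2).
Proof.
move=> hw; have [[refl trans] _] := hw; split.
  split=> [x|x y z [-> h1] [-> h2]]; first by split.
  by split=> //; apply: trans h2.
move=> s; have [f [fi fl]] := monotone_subsequence (fun n => (s n).2) hw.
have : ~~ injectiveb (fun i : 'I_#|T|.+1 => (s (f i)).1).
  by apply/injectiveP => /leq_card; rewrite card_ord ltnn.
case/injectivePn => i [j ij e].
case: (ltngtP i j) => h; last by rewrite (val_inj h) eqxx in ij.
- by exists (f i), (f j); split; [apply: fi|split=> //; apply: fl].
- by exists (f j), (f i); split; [apply: fi|split=> //; apply: fl].
Qed.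

(** * Spirals *)

(** The order of the drawing for columns of opposite parity when each column has one vertex and rows
    descend: the next vertex precedes the current one. *)
Definition spiral_lt (i j : nat) := (i.+1 < j) || (i == j.+1).

Lemma gadj_spiral t n (i j : 'I_n) : gadj (spiral t n) i j =
  if odd i == odd j then [&& i != j, t & odd i] else odd i (+) spiral_lt i j.
Proof.
rewrite /= /zrel; case: (altP (odd i =P odd j)) => o; first by rewrite /zadj o eqxx.
have ij : i != j by apply: contraNneq o => ->.
have hi := ltn_ord i; have hj := ltn_ord j.
rewrite ij zadj_lt //=; last by move: o hi hj; clear; lia.
congr addb; rewrite /zlt /spiral_lt; move: o hi hj; clear; lia.
Qed.

Section SpiralEmbedding.
Variables (t : bool) (m n : nat) (f : 'I_m -> 'I_n).
Hypothesis m6 : 6 <= m.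
Hypothesis m_even : ~~ odd m.
Hypothesis femb : @induced_emb (spiral t m) (spiral t n) f.

Let fI : injective f. Proof. by case: femb. Qed.
Let fE u v : gadj (spiral t m) u v = gadj (spiral t n) (f u) (f v). Proof. by case: femb. Qed.

Let F (i : nat) : nat := if insub i is Some u then f u else 0.

Lemma F_ord (u : 'I_m) : F u = f u.
Proof. by rewrite /F valK. Qed.

Lemma F_gadj i j : i < m -> j < m -> odd i != odd j ->
  odd i (+) spiral_lt i j =
  if odd (F i) == odd (F j) then [&& F i != F j, t & odd (F i)] else odd (F i) (+) spiral_lt (F i) (F j).
Proof.
move=> hi hj o; have := fE (Ordinal hi) (Ordinal hj).
by rewrite !gadj_spiral /= (negPf o) -(inj_eq val_inj) /= -!F_ord.
Qed.

Lemma F_inj i j : i < m -> j < m -> F i = F j -> i = j.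
Proof.
move=> hi hj; rewrite -[i]/(val (Ordinal hi)) -[j]/(val (Ordinal hj)) !F_ord.
by move=> /val_inj /fI ->.
Qed.

Lemma F_same i j : i < m -> j < m -> odd i = odd j -> i != j ->
  (t && odd i) =
  if odd (F i) == odd (F j) then t && odd (F i) else odd (F i) (+) spiral_lt (F i) (F j).
Proof.
move=> hi hj o ij; have := fE (Ordinal hi) (Ordinal hj).
rewrite !gadj_spiral /= o eqxx -!(inj_eq val_inj) /= ij -!F_ord /= => ->.
by case: eqP => // _; case: eqP => // /(F_inj hi hj) e; rewrite e eqxx in ij.
Qed.

(** For [t = true] the clique side must be kept. For [t = false] a spiral of length at least 6 is
    connected, so its two sides are kept or exchanged as a whole. *)
Lemma spiral_sides : exists b, forall i, i < m -> odd (F i) = odd i (+) b.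
Proof.
case: t fE F_gadj F_same => _ H1 H2.
- exists false.
  have nn i j : i < m -> j < m -> odd (F i) = odd (F j) -> odd i != odd j ->
     odd i (+) spiral_lt i j = odd (F i).
    move=> hi hj e o; rewrite H1 // e eqxx /=.
    by case: eqP => // /(F_inj hi hj) ij; rewrite ij eqxx in o.
  have h1 j : 2 < j -> j < m -> odd j -> odd (F j).
    move=> j2 jm oj; apply/negPn/negP => /negPf ne.
    have key i : i < m -> ~~ odd i -> spiral_lt i j -> odd (F i).
      move=> hi oi l; apply/negPn/negP => /negPf ne'.
      by have := nn i j hi jm; rewrite ne ne' (negPf oi) oj l => /(_ erefl isT).
    pose i := if j == 3 then 4 else 2.
    have k0 : odd (F 0) by apply: key => //; [move: m6|rewrite /spiral_lt]; move: j2; clear; lia.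
    have ki : odd (F i).
      by apply: key; rewrite /i /spiral_lt; move: j2 m6 jm oj; clear; case: (j =P 3); lia.
    have := H2 0 i _ _ _ _; rewrite k0 ki /= => /(_ _ _ _ _) h.
    have hi : i < m by rewrite /i; case: ifP => _; move: m6; clear; lia.
    suff : false by []. apply: h => //; [by move: m6; clear; lia|by rewrite /i; case: ifP|by rewrite /i; case: ifP].
  have h2 i : 1 < i -> i < m -> ~~ odd i -> ~~ odd (F i).
    move=> i1 im oi; apply/negP => od.
    have im' : i.+1 < m by move: im oi m_even; clear; lia.
    have o' := h1 i.+1 i1 im' oi.
    have := nn i i.+1 im im'; rewrite od o' /= (negPf oi) /= => /(_ erefl isT).
    by rewrite /spiral_lt; clear; lia.
  have m1 : 1 < m by move: m6; clear; lia.
  have m0 : 0 < m by move: m6; clear; lia.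
  have m2 : 2 < m by move: m6; clear; lia.
  have h3 : odd (F 1).
    apply/negPn/negP => /negPf ne; have /negPf ne' := h2 2 isT m2 isT.
    by have := nn 2 1 m2 m1; rewrite ne ne' => /(_ erefl isT).
  have h4 : odd (F 0) = false.
    apply/negP => o0; have := nn 0 1 m0 m1.
    by rewrite h3 o0 => /(_ erefl isT).
  move=> i im; rewrite addbF; case: i im => [|[|i]] im //.
  case oi: (odd i.+2); first by apply: h1 => //; case: i im oi.
  by apply/negbTE/h2 => //; rewrite oi.
- exists (odd (F 0)).
  have nn i j : i < m -> j < m -> odd i != odd j ->
     odd i (+) spiral_lt i j -> odd (F i) (+) odd i = odd (F j) (+) odd j.
    move=> hi hj o; rewrite H1 //; case: ifP => [_|]; first by rewrite andbF.
    by move: o; case: (odd i); case: (odd j); case: (odd (F i)); case: (odd (F j)).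
  have m0 : 0 < m by move: m6; clear; lia.
  have h1 j : 2 < j -> j < m -> odd j -> odd (F j) (+) odd j = odd (F 0).
    move=> j2 jm oj; rewrite -(nn 0 j) ?addbF ?oj //.
    by rewrite /spiral_lt /=; move: j2; clear; lia.
  have h2 i : 3 < i -> i < m -> ~~ odd i -> odd (F i) (+) odd i = odd (F 0).
    move=> i1 im oi; have im' : i.-1 < m by move: im; clear; lia.
    rewrite -(h1 i.-1 _ im'); try by move: i1 oi; clear; lia.
    by apply: nn => //; rewrite /spiral_lt; move: i1 oi; clear; lia.
  have m5 : 5 < m by [].
  have m2 : 2 < m by move: m6; clear; lia.
  have m1 : 1 < m by move: m6; clear; lia.
  have h3 : odd (F 2) (+) odd 2 = odd (F 0) by rewrite (nn 2 5) // h1.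
  have h4 : odd (F 1) (+) odd 1 = odd (F 0) by rewrite -(nn 2 1) // h3.
  move=> i im; rewrite addbC; suff <- : odd (F i) (+) odd i = odd (F 0) by rewrite -addbA addbb addbF.
  case: i im => [|[|[|i]]] im //; first by rewrite addbF.
  case oi: (odd i.+3); first by rewrite -oi h1.
  by rewrite -oi h2 ?oi //; case: i im oi.
Qed.

(** Every vertex is preceded by the next one, and the embedding preserves this order, or reverses it
    when the sides are exchanged. Hence the image column grows by at most one per step, read
    forwards or backwards. The ends have opposite parities, so the two marked vertices go to
    different ends. *)
Lemma spiral_ends : ~~ odd n ->
  (forall u : 'I_m, (val u == 0) || (u.+1 == m) -> f u = 0 :> nat \/ f u = n.-1 :> nat) ->
  n <= m.
Proof.
move=> ne ends; have [b hb] := spiral_sides.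
have n0 : 0 < n by apply: leq_ltn_trans (ltn_ord (f (Ordinal m6))).
have m0 : 0 < m by move: m6; clear; lia.
have odd_n1 : odd n.-1 by move: ne n0; clear; lia.
have odd_m1 : odd m.-1 by move: m_even m0; clear; lia.
have st i : i.+1 < m -> spiral_lt (F (if b then i else i.+1)) (F (if b then i.+1 else i)).
  move=> hi; have hi' := ltnW hi.
  have o : odd i.+1 != odd i by rewrite /=; case: (odd i).
  have o' : odd i != odd i.+1 by rewrite eq_sym.
  have := F_gadj hi hi' o; have := F_gadj hi' hi o'.
  rewrite !hb // -[odd i.+1]/(~~ odd i).
  have -> : spiral_lt i.+1 i by rewrite /spiral_lt eqxx orbT.
  have -> : spiral_lt i i.+1 = false by rewrite /spiral_lt; clear; lia.
  case: b hb => hb; case: (odd i) => /=;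
  by case: (spiral_lt (F i) (F i.+1)); case: (spiral_lt (F i.+1) (F i)).
have m1 : m.-1 < m by rewrite prednK.
have e0 : F 0 = 0 \/ F 0 = n.-1 by rewrite (F_ord (Ordinal m0)); apply: ends.
have e1 : F m.-1 = 0 \/ F m.-1 = n.-1.
  by rewrite (F_ord (Ordinal m1)); apply: ends; rewrite /= prednK // eqxx orbT.
have hb0 := hb 0 m0; have hb1 := hb _ m1; rewrite odd_m1 in hb1.
case: b st hb0 hb1 {hb} => st hb0 hb1.
- have E0 : F 0 = n.-1 by case: e0 => // e0; rewrite e0 in hb0.
  have E1 : F m.-1 = 0 by case: e1 => // e1; rewrite e1 odd_n1 in hb1.
  have h i : i < m -> F 0 <= F i + i.
    elim: i => [|i IH] hi; first by rewrite addn0.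
    have := st i hi; have := IH (ltnW hi); rewrite /spiral_lt /=; clear; lia.
  by have := h _ m1; rewrite E0 E1; move: n0 m0; clear; lia.
- have E0 : F 0 = 0 by case: e0 => // e0; rewrite e0 odd_n1 in hb0.
  have E1 : F m.-1 = n.-1 by case: e1 => // e1; rewrite e1 in hb1.
  have h i : i < m -> F i <= F 0 + i.
    elim: i => [|i IH] hi; first by rewrite addn0.
    have := st i hi; have := IH (ltnW hi); rewrite /spiral_lt /=; clear; lia.
  by have := h _ m1; rewrite E0 E1; move: n0 m0; clear; lia.
Qed.

End SpiralEmbedding.

Definition marked_spiral t n : lab_graph bool :=
  @LabGraph bool (spiral t n) (fun i : 'I_n => (val i == 0) || (i.+1 == n)).

(** Even lengths give the two ends opposite parities, and length 6 is the least that [spiral_sides]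
    handles. *)
Definition spiral_seq t i := marked_spiral t (2 * i + 6).

Lemma spiral_seq_antichain t : lab_antichain (@eq bool) (spiral_seq t).
Proof.
move=> i j ij [f [femb fl]].
have [h|h] : j < i \/ i < j by move: ij; clear; lia.
  have := leq_card f (proj1 femb); rewrite /= !card_ord; move: h; clear; lia.
set m := 2 * i + 6; set n := 2 * j + 6.
have m6 : 6 <= m by rewrite /m; clear; lia.
have me : ~~ odd m by rewrite /m; clear; lia.
have ne : ~~ odd n by rewrite /n; clear; lia.
have nm : m < n by rewrite /m /n; move: h; clear; lia.
have lab (u : 'I_m) : (val u == 0) || (u.+1 == m) -> f u = 0 :> nat \/ f u = n.-1 :> nat.
  move=> hu; have /= := fl u; rewrite hu => /esym /orP[/eqP e|/eqP e]; [by left|right].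
  exact: (congr1 predn e).
by have := @spiral_ends t m n f m6 me femb ne lab; rewrite leqNgt nm.
Qed.

(** * Labelled well-quasi-ordering *)

(** Following search predecessors down from [v] gives one vertex per layer of a single piece, with
    rows increasing as layers decrease. *)
Lemma srep_spiral t G piece lay row v N : @srep t G piece lay row -> N < lay v ->
  induced_sub (spiral t N) G.
Proof.
case=> rI rp ga bfs Nv.
have bfs' u : {w | 1 < lay u -> [/\ piece w = piece u, (lay w).+1 = lay u & row u < row w]}.
  apply: constructive_indefinite_description; case: (ltnP 1 (lay u)) => [/bfs [w hw]|h]; first by exists w.
  by exists u.
pose par u := sval (bfs' u).
pose x d := iter d par v.
have xs d : d < (lay v).-1 -> [/\ piece (x d.+1) = piece (x d), (lay (x d.+1)).+1 = lay (x d) & row (x d) < row (x d.+1)].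
  have lx : d < lay v -> lay (x d) = lay v - d.
    elim: d => [|d IH] hd; first by rewrite subn0.
    have [_ e _] : [/\ piece (x d.+1) = piece (x d), (lay (x d.+1)).+1 = lay (x d) & row (x d) < row (x d.+1)].
      by apply: (svalP (bfs' (x d))); rewrite IH; move: hd; clear; lia.
    by move: e; rewrite IH; move: hd; clear; lia.
  by move=> hd; apply: (svalP (bfs' (x d))); rewrite lx; move: hd; clear; lia.
have lx d : d < lay v -> lay (x d) = lay v - d /\ piece (x d) = piece v.
  elim: d => [|d IH] hd; first by rewrite subn0.
  have [|e1 e2 _] := xs d; first by move: hd; clear; lia.
  have [h1 h2] := IH (ltnW hd); rewrite e1; split=> //; move: e2; rewrite h1; move: hd; clear; lia.
have rx d d' : d < d' -> d' < lay v -> row (x d) < row (x d').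
  elim: d' => // d' IH; rewrite ltnS leq_eqVlt => dd hd'.
  have [|_ _ l] := xs d'; first by move: hd'; clear; lia.
  by case/orP: dd => [/eqP ->//|/IH h]; apply: ltn_trans (h (ltnW hd')) l.
(* The path is sure to reach layer 1 but perhaps not layer 0, so the spiral starts in layer 2, which
   keeps parities. *)
pose g (i : 'I_N) := x (lay v - (2 + i)).
have gb (i : 'I_N) : lay v - (2 + i) < lay v by move: (ltn_ord i) Nv; clear; lia.
have gl (i : 'I_N) : lay (g i) = 2 + i.
  by rewrite /g (lx _ (gb i)).1; move: (ltn_ord i) Nv; clear; lia.
have gp (i : 'I_N) : piece (g i) = piece v by rewrite /g (lx _ (gb i)).2.
have gr (i j : 'I_N) : (row (g i) < row (g j)) = (N - i < N - j).
  have [hi hj] := (ltn_ord i, ltn_ord j).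
  case: (ltngtP i j) => ij.
  - have h : row (g j) < row (g i) by apply: rx (gb i); move: ij hi hj Nv; clear; lia.
    have -> : (N - i < N - j) = false by move: ij hi hj; clear; lia.
    by rewrite ltnNge ltnW.
  - have -> : row (g i) < row (g j) by apply: rx (gb j); move: ij hi hj Nv; clear; lia.
    by move: ij hi hj; clear; lia.
  - by rewrite (val_inj ij) !ltnn.
exists g; split=> [i j e|i j].
  by apply: val_inj; have := gl i; rewrite e gl => /addnI.
have gI : (g i == g j) = (i == j).
  by apply/eqP/eqP => [e|-> //]; apply: val_inj; have := gl i; rewrite e gl => /addnI.
have slE a b : slt piece lay row (g a) (g b) = zlt a (N - a) b (N - b).
  by rewrite /slt !gp ltnn eqxx !gl zlt_shift /zlt gr.
by rewrite ga /= /zrel gI !slE !gl /zadj !oddD.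
Qed.

Section Words.
Variables (W : Type) (B : nat).

Definition piece_word (A : lab_graph W) (piece lay row : gV (lg A) -> nat) p :=
  sort (fun u v => row u <= row v) [seq v <- enum (gV (lg A)) | piece v == p].

Definition graph_word (A : lab_graph W) (piece lay row : gV (lg A) -> nat) :=
  [seq [seq ((inord (lay v) : 'I_B.+1), lgl A v) | v <- piece_word piece lay row p]
  | p <- iota 0 (\max_v piece v).+1].

Lemma mem_piece_word (A : lab_graph W) (piece lay row : gV (lg A) -> nat) p v :
  (v \in piece_word piece lay row p) = (piece v == p).
Proof. by rewrite mem_sort mem_filter mem_enum andbT. Qed.

Lemma piece_word_index (A : lab_graph W) (piece lay row : gV (lg A) -> nat) p u v :
  injective row -> piece u = p -> piece v = p ->
  (index u (piece_word piece lay row p) < index v (piece_word piece lay row p)) = (row u < row v).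
Proof.
move=> rI pu pv; set s := piece_word _ _ _ _.
have us : u \in s by rewrite mem_piece_word pu.
have vs : v \in s by rewrite mem_piece_word pv.
have tr : transitive (fun u v : gV (lg A) => row u <= row v) by move=> ? ? ?; apply: leq_trans.
have so : sorted (fun u v : gV (lg A) => row u <= row v) s.
  by apply: sort_sorted => a b; apply: leq_total.
have le x y : x \in s -> y \in s -> index x s < index y s -> row x <= row y.
  by move=> xs ys; apply: (sorted_ltn_index tr so).
apply/idP/idP => h.
  rewrite ltn_neqAle le // andbT (inj_eq rI).
  by apply: contraTneq h => ->; rewrite ltnn.
rewrite ltnNge; apply/negP; rewrite leq_eqVlt => /orP[/eqP e|/(le _ _ vs us)]; last by rewrite leqNgt h.
by move: h; rewrite -(nth_index u us) -e (nth_index u vs) ltnn.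
Qed.

Variable le : W -> W -> Prop.

(** Adjacency depends only on the order of the pieces, the layers, and the order of rows inside one
    piece. The outer embedding preserves the first, the letters carry the second, and each inner
    embedding preserves the third. *)
Lemma graph_word_embeds t (A A' : lab_graph W)
    (piece lay row : gV (lg A) -> nat) (piece' lay' row' : gV (lg A') -> nat) :
  srep t piece lay row -> srep t piece' lay' row' ->
  (forall v, lay v <= B) -> (forall v, lay' v <= B) ->
  embeds (embeds (fun x y : 'I_B.+1 * W => x.1 = y.1 /\ le x.2 y.2))
    (graph_word piece lay row) (graph_word piece' lay' row') ->
  lab_sub le A A'.
Proof.
move=> [rI _ ga _] [rI' _ ga' _] lB lB' /embeds_index [F [F1 F2]].
rewrite /graph_word !size_map !size_iota in F1 F2.
set P := (\max_v piece v).+1 in F1 F2; set P' := (\max_v piece' v).+1 in F2.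
have pP v : piece v < P by rewrite ltnS; apply: (leq_bigmax (F := piece) v).
pose w := piece_word piece lay row; pose w' := piece_word piece' lay' row'.
pose enc u := ((inord (lay u) : 'I_B.+1), lgl A u).
pose enc' u := ((inord (lay' u) : 'I_B.+1), lgl A' u).
have inner p : {f : nat -> nat | p < P ->
    (forall i j, i < j -> j < size (w p) -> f i < f j) /\
    forall i, i < size (w p) -> f i < size (w' (F p)) /\ forall x y,
      (nth x (map enc (w p)) i).1 = (nth y (map enc' (w' (F p))) (f i)).1 /\
      le (nth x (map enc (w p)) i).2 (nth y (map enc' (w' (F p))) (f i)).2}.
  apply: constructive_indefinite_description; case: (ltnP p P) => hp; last by exists id.
  have [hF /(_ [::] [::])] := F2 p hp.
  rewrite !(nth_map 0) ?size_iota // !nth_iota // !add0n => /embeds_index [f [f1 f2]].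
  by exists f => _; rewrite !size_map in f1 f2; split.
pose f p := sval (inner p).
have fS p : p < P -> _ := svalP (inner p).
have iw u : index u (w (piece u)) < size (w (piece u)) by rewrite index_mem mem_piece_word.
have ex u : {v | [/\ piece' v = F (piece u),
    index v (w' (F (piece u))) = f (piece u) (index u (w (piece u))),
    lay' v = lay u & le (lgl A u) (lgl A' v)]}.
  apply: constructive_indefinite_description.
  have [_ /(_ _ (iw u)) [fi h]] := fS _ (pP u).
  have v0 : gV (lg A') by case: (w' _) (leq_ltn_trans (leq0n _) fi) => [//|v0 r _]; exact: v0.
  set v := nth v0 (w' (F (piece u))) (f (piece u) (index u (w (piece u)))).
  exists v.
  have uw : uniq (w' (F (piece u))) by rewrite sort_uniq filter_uniq ?enum_uniq.
  have := h (enc u) (enc' v0); rewrite !(nth_map u) // !(nth_map v0) // -/v nth_index ?mem_piece_word //.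
  move=> [/(congr1 val) e1 l1]; split=> //.
  - by apply/eqP; rewrite -(@mem_piece_word A' piece' lay' row') mem_nth.
  - by rewrite index_uniq.
  - by move: e1; rewrite /= !inordK ?ltnS.
have [g gS] : exists g : gV (lg A) -> gV (lg A'), forall u, [/\ piece' (g u) = F (piece u),
    index (g u) (w' (F (piece u))) = f (piece u) (index u (w (piece u))),
    lay' (g u) = lay u & le (lgl A u) (lgl A' (g u))].
  by exists (fun u => sval (ex u)) => u; apply: (svalP (ex u)).
have gp u : piece' (g u) = F (piece u) by have [] := gS u.
have gl u : lay' (g u) = lay u by have [] := gS u.
have gr u v : piece u = piece v -> (row' (g u) < row' (g v)) = (row u < row v).
  move=> puv; have [p1 i1 _ _] := gS u; have [p2 i2 _ _] := gS v.
  rewrite -(@piece_word_index A' piece' lay' row' (F (piece u))) ?gp -?puv //.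
  rewrite -(@piece_word_index A piece lay row (piece u)) // -/(w' _) -/(w _) i1.
  rewrite -puv in i2; rewrite i2.
  have [mono _] := fS _ (pP u).
  have hu := iw u; have hv := iw v; rewrite -puv in hv.
  case: (ltngtP (index u (w (piece u))) (index v (w (piece u)))) => h.
  - exact: mono.
  - by apply/negbTE; rewrite -leqNgt ltnW // mono.
  - by rewrite h ltnn.
have Flt p q : p < P -> q < P -> (F p < F q) = (p < q).
  move=> hp hq; case: (ltngtP p q) => h; first exact: F1.
  - by apply/negbTE; rewrite -leqNgt ltnW // F1.
  - by rewrite h ltnn.
have gI : injective g.
  move=> u v e; have pe : piece u = piece v.
    have := Flt _ _ (pP u) (pP v); have := Flt _ _ (pP v) (pP u).
    rewrite -!gp e !ltnn; clear; lia.
  apply: rI; have := gr _ _ pe; have := gr _ _ (esym pe).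
  rewrite e !ltnn; clear; lia.
exists g; split; last by move=> v; have [] := gS v.
split=> // u v; rewrite ga ga' (inj_eq gI) !gl; congr andb.
have slE x y : slt piece' lay' row' (g x) (g y) = slt piece lay row x y.
  rewrite /slt !gp Flt // !gl; congr orb.
  case: (eqVneq (piece x) (piece y)) => [e|ne] /=.
    by rewrite e eqxx /= /zlt gr.
  apply/negbTE; apply: contra ne => /andP[/eqP e _].
  have := Flt _ _ (pP x) (pP y); have := Flt _ _ (pP y) (pP x).
  by rewrite e ltnn; clear; lia.
by rewrite !slE.
Qed.
End Words.

Lemma bounded_layers_lab_wqo t (C : graph_class) B :
  (forall G, C G -> exists piece lay row, @srep t G piece lay row /\ forall v, lay v <= B) ->
  lab_wqo C.
Proof.
move=> hC W le hw [A [CA anti]].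
have ex i : {ww : seq (seq ('I_B.+1 * W)) | exists piece lay row,
    [/\ @srep t (lg (A i)) piece lay row, forall v, lay v <= B & ww = graph_word B piece lay row]}.
  apply: constructive_indefinite_description.
  have [piece [lay [row [h1 h2]]]] := hC _ (CA i).
  by exists (graph_word B piece lay row), piece, lay, row.
have [_ /(_ (fun i => sval (ex i)))] := higman (higman (wqo_fin_prod 'I_B.+1 hw)).
case=> i [j [ij]].
have [p [l [r [h1 h2 ->]]]] := svalP (ex i).
have [p' [l' [r' [h1' h2' ->]]]] := svalP (ex j).
move/(graph_word_embeds h1 h1' h2 h2'); apply: anti.
by move=> e; rewrite e ltnn in ij.
Qed.

(** * The two classes and their antichains *)

Lemma grid_free_bounded t D : hereditary D -> (forall G, D G -> zclass t G) ->
  (exists G, zclass t G /\ ~ D G) -> bounded_cw D.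
Proof.
move=> hD Dz [G0 [zG0 nD]].
have [N hN] := zclass_sub_grid zG0.
(* The successor [N.+1] makes the excluded grid nonempty, as [grid_free_cw] requires. *)
exists (#|{: prefix_class N.+1}|.+1 + #|{: prefix_class N.+1}|) => G DG.
have [col [row rep]] := Dz G DG.
apply: (grid_free_cw rep) => // sub.
by apply: nD; exact: hD (hD _ _ DG sub) (hN _ (leqnSn N)).
Qed.

Lemma zclass_minimal t : minimal_unbounded_cw (zclass t).
Proof.
split; first exact: zclass_hereditary.
- case=> k hk; have [n hn] := grid_unbounded_cw t k.
  by apply: hn; apply: hk; apply: grid_graph_zclass.
- exact: grid_free_bounded.
Qed.

Lemma zclass_canonical t :
  (forall G, zclass t G -> exists piece lay row, @srep t G piece lay row) ->
  canonical_antichain (zclass t) (@eq bool) (spiral_seq t).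
Proof.
move=> zs; split.
- by move=> i; apply: spiral_zclass.
- exact: spiral_seq_antichain.
- move=> D hD Dz [N hN].
  (* The bound is the length of the excluded spiral of index [N]; a larger layer would contain that
     spiral. *)
  apply: (@bounded_layers_lab_wqo t _ (2 * N + 6)) => G DG.
  have [piece [lay [row rep]]] := zs G (Dz G DG).
  exists piece, lay, row; split=> // v; rewrite leqNgt; apply/negP => h.
  by apply: (hN N (leqnn N)); apply: hD (srep_spiral rep h).
Qed.

Lemma minimal_unbounded_cw_ext (C C' : graph_class) :
  (forall G, C G <-> C' G) -> minimal_unbounded_cw C -> minimal_unbounded_cw C'.
Proof.
move=> e [h1 h2 h3]; split.
- by move=> G H /e c s; apply/e; apply: h1 s.
- by case=> k hk; apply: h2; exists k => G /e; apply: hk.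
- move=> D hD DC [G [/e CG nG]]; apply: h3 => //; last by exists G.
  by move=> H /DC /e.
Qed.

Lemma canonical_antichain_ext (C C' : graph_class) W (le : W -> W -> Prop) A :
  (forall G, C G <-> C' G) -> canonical_antichain C le A -> canonical_antichain C' le A.
Proof.
move=> e [h1 h2 h3]; split=> // [i|D hD DC]; first exact/e.
by apply: h3 => // H /DC /e.
Qed.

Lemma zclass_bichainE G : zclass false G <-> bichain G.
Proof.
split; first exact: zclass_bichain.
by case/bichain_srep => piece [lay [row h]]; apply: srep_zclass h.
Qed.

Lemma zclass_split_permutationE G : zclass true G <-> split_permutation G.
Proof.
split; first exact: zclass_split_permutation.
by case/split_permutation_srep => piece [lay [row h]]; apply: srep_zclass h.
Qed.

Theorem theorem1 :
  [/\ minimal_unbounded_cw bichain,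
      minimal_unbounded_cw split_permutation,
      (exists A : nat -> lab_graph bool, canonical_antichain bichain (@eq bool) A)
    & (exists A : nat -> lab_graph bool,
         canonical_antichain split_permutation (@eq bool) A)].
Proof.
split.
- exact: minimal_unbounded_cw_ext zclass_bichainE (zclass_minimal false).
- exact: minimal_unbounded_cw_ext zclass_split_permutationE (zclass_minimal true).
- exists (spiral_seq false); apply: canonical_antichain_ext zclass_bichainE (zclass_canonical _).
  by move=> G /zclass_bichainE; apply: bichain_srep.
- exists (spiral_seq true); apply: canonical_antichain_ext zclass_split_permutationE (zclass_canonical _).
  by move=> G /zclass_split_permutationE; apply: split_permutation_srep.
Qed.
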